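(* Let $\Bbbk$ be a unital commutative ring, let $A$ be a $\Bbbk$-algebra which is projective as a $\Bbbk$-module, let $\sigma$ be an algebra automorphism of $A$, let $\delta$ be a $\sigma$-derivation of $A$, and let $E=A[x;\sigma,\delta]$ be the Ore extension. Suppose that $A$ admits a finitely generated projective resolution as an $A^e$-module (i.e. a projective resolution all of whose terms are finitely generated). Then for any $n\in\mathbb{N}$ there is an exact sequence of $E^e$-modules $$0\to H^{n}(A,E\otimes E)\to H^{n}(A,E\otimes E^{\sigma^{-1}})\to H^{n+1}(E,E\otimes E)\to 0.$$
   Context: Unadorned $\otimes$ means $\otimes_{\Bbbk}$; $\mathbb{N}$ contains $0$. For an algebra $B$, $B^e=B\otimes B^{\mathrm{op}}$, and $B^e$-modules are $B$-$B$-bimodules. A $\sigma$-derivation is a $\Bbbk$-linear map $\delta\colon A\to A$ with $\delta(ab)=\delta(a)b+\sigma(a)\delta(b)$. The Ore extension $E=A[x;\sigma,\delta]$ is the ring extension of $A$ that is a free left $A$-module with basis $\{1,x,x^2,\dots\}$ and satisfies $xa=\sigma(a)x+\delta(a)$ for all $a\in A$. $H^*(B,M)$ denotes Hochschild cohomology of the algebra $B$ with coefficients in the $B$-$B$-bimodule $M$. Bimodule structures: $E\otimes E$ has the outer $E$-bimodule structure $a\cdot(m\otimes n)\cdot b=am\otimes nb$ and the inner $E$-bimodule structure $a\cdot(m\otimes n)\cdot b=mb\otimes an$; the two commute. In $H^{n+1}(E,E\otimes E)$ the coefficient bimodule is $E\otimes E$ with the outer structure, and in $H^n(A,E\otimes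 E)$ it is $E\otimes E$ with the outer structure restricted to $A$. $E\otimes E^{\sigma^{-1}}$ is the $\Bbbk$-module $E\otimes E$ with the $A$-bimodule structure $a\cdot(m\otimes n)\cdot b=am\otimes n\sigma^{-1}(b)$ for $a,b\in A$. All three cohomology groups are $E^e$-modules via the structure induced by the inner $E$-bimodule structure on $E\otimes E$. *)

(* Defs.v *)
From HB Require Import structures.
From mathcomp Require Import all_boot all_algebra.
From mathcomp Require Import generic_quotient ring_quotient.
From mathcomp Require Import boolp classical_sets functions.

Set Implicit Arguments.
Unset Strict Implicit.
Unset Printing Implicit Defensive.

Import GRing.Theory.
Local Open Scope ring_scope.
Local Open Scope quotient_scope.

(* A k-algebra is a ring with a central ring morphism from k.  The library's
   algType excludes the zero algebra, and its hierarchy leaves no room for a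
   join of pzRingType and lmodType. *)
HB.mixin Record isKAlgebra (k : comPzRingType) A of GRing.PzRing A := {
  kunit : k -> A;
  kunit_zmod_morphism : zmod_morphism kunit;
  kunit_monoid_morphism : monoid_morphism kunit;
  kunit_central : forall (c : k) (a : A), kunit c * a = a * kunit c
}.
#[short(type="kAlgType")]
HB.structure Definition KAlgebra (k : comPzRingType) :=
  {A of GRing.PzRing A & isKAlgebra k A}.

Section KAlgebraModule.
Variables (k : comPzRingType) (A : kAlgType k).

HB.instance Definition _ :=
  GRing.isZmodMorphism.Build k A (@kunit k A) (@kunit_zmod_morphism k A).
HB.instance Definition _ :=
  GRing.isMonoidMorphism.Build k A (@kunit k A) (@kunit_monoid_morphism k A).

Definition kscale (c : k) (a : A) : A := kunit c * a.

Lemma kscaleA a b v : kscale a (kscale b v) = kscale (a * b) v.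
Proof. by rewrite /kscale rmorphM mulrA. Qed.
Lemma kscale1 : left_id 1 kscale.
Proof. by move=> x; rewrite /kscale rmorph1 mul1r. Qed.
Lemma kscaleDr : right_distributive kscale +%R.
Proof. by move=> c x y; rewrite /kscale mulrDr. Qed.
Lemma kscaleDl x : {morph kscale^~ x : a b / a + b}.
Proof. by move=> a b; rewrite /kscale rmorphD mulrDl. Qed.

#[non_forgetful_inheritance]
HB.instance Definition _ := GRing.Zmodule_isLmodule.Build k (KAlgebra.sort A)
  kscaleA kscale1 kscaleDr kscaleDl.

Lemma kscaleE (c : k) (a : A) : c *: a = kunit c * a. Proof. by []. Qed.
Lemma kscaleAl (c : k) (a b : A) : c *: (a * b) = (c *: a) * b.
Proof. by rewrite !kscaleE mulrA. Qed.
Lemma kscaleAr (c : k) (a b : A) : c *: (a * b) = a * (c *: b).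
Proof. by rewrite !kscaleE !mulrA kunit_central. Qed.

End KAlgebraModule.

Record alg_hom (k : comPzRingType) (A B : kAlgType k) := AlgHom {
  alg_fun :> {rmorphism A -> B};
  alg_funZ : scalable alg_fun
}.

Record alg_aut (k : comPzRingType) (A : kAlgType k) := AlgAut {
  aut_fun :> alg_hom A A;
  aut_inv : alg_hom A A;
  autK : cancel aut_fun aut_inv;
  aut_invK : cancel aut_inv aut_fun
}.

Record skew_derivation (k : comPzRingType) (A : kAlgType k)
    (sigma : alg_aut A) := SkewDerivation {
  sder_fun :> {linear A -> A};
  sderM : forall a b, sder_fun (a * b) = sder_fun a * b + sigma a * sder_fun b
}.

(* Ore extensions are given by their defining property rather than by a model;
   [ore_gen] and [ore_free] say that the powers of x form a basis of E as a
   left A-module. *)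
Record ore_extension (k : comPzRingType) (A : kAlgType k)
    (sigma : alg_aut A) (delta : skew_derivation sigma) := OreExtension {
  ore_alg :> kAlgType k;
  ore_incl : alg_hom A ore_alg;
  ore_var : ore_alg;
  ore_gen : forall e : ore_alg, exists (m : nat) (c : nat -> A),
    e = \sum_(i < m) ore_incl (c i) * ore_var ^+ i;
  ore_free : forall (m : nat) (c : nat -> A),
    \sum_(i < m) ore_incl (c i) * ore_var ^+ i = 0 ->
    forall i, (i < m)%N -> c i = 0;
  ore_comm : forall a : A,
    ore_var * ore_incl a = ore_incl (sigma a) * ore_var + ore_incl (delta a)
}.

Definition projective_module (k : comPzRingType) (P : lmodType k) : Prop :=
  forall (M N : lmodType k) (p : {linear M -> N}) (f : {linear P -> N}),
    (forall y, exists x, p x = y) ->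
    exists g : {linear P -> M}, forall z, p (g z) = f z.

Section TensorProduct.
Variables (k : comPzRingType) (U V : lmodType k).

Definition bilinear_map (W : lmodType k) (phi : U -> V -> W) : Prop :=
  (forall v, linear (phi^~ v)) /\ (forall u, linear (phi u)).

Definition formal_sum (W : lmodType k) (phi : U -> V -> W) (s : seq (U * V)) : W :=
  \sum_(p <- s) phi p.1 p.2.

(* U (x) V is the quotient of the formal sums of pairs which identifies two
   sums when no bilinear map separates them.  See [tensor_liftE] and
   [tensor_lift_unique] for the universal property. *)
Definition tensor_eq (s t : seq (U * V)) : bool :=
  `[< forall (W : lmodType k) (phi : U -> V -> W),
        bilinear_map phi -> formal_sum phi s = formal_sum phi t >].

Lemma tensor_eq_equiv : equiv_class_of tensor_eq.
Proof.
split=> [s|s t|t s r].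
- by apply/asboolP.
- by apply/asboolP/asboolP => h W phi hb; rewrite h.
- by move=> /asboolP h1 /asboolP h2; apply/asboolP => W phi hb; rewrite h1 // h2.
Qed.
Canonical tensor_eq_canonical := EquivRelPack tensor_eq_equiv.
Canonical tensor_eq_encModRel := defaultEncModRel tensor_eq.

Definition tensor : Type := {eq_quot tensor_eq}.
HB.instance Definition _ := Choice.on tensor.
HB.instance Definition _ := EqQuotient.on tensor.

Definition tpure (u : U) (v : V) : tensor := \pi_tensor [:: (u, v)].

Lemma formal_sum_scale (W : lmodType k) (phi : U -> V -> W) (c : k) s :
  bilinear_map phi ->
  formal_sum phi [seq (c *: p.1, p.2) | p <- s] = c *: formal_sum phi s.
Proof.
move=> [h1 _]; rewrite /formal_sum big_map scaler_sumr; apply: eq_bigr => p _ /=.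
have := h1 p.2 c p.1 0; rewrite addr0 => ->.
by have := h1 p.2 1 0 0; rewrite scaler0 addr0 scale1r -{1}[phi 0 p.2]addr0 => /addrI <-; rewrite addr0.
Qed.

Lemma tensor_piP s t : reflect
  (forall (W : lmodType k) (phi : U -> V -> W),
     bilinear_map phi -> formal_sum phi s = formal_sum phi t)
  (\pi_tensor s == \pi_tensor t).
Proof. by rewrite eqmodE; apply: asboolP. Qed.

Lemma tensor_repr (W : lmodType k) (phi : U -> V -> W) s : bilinear_map phi ->
  formal_sum phi (repr (\pi_tensor s)) = formal_sum phi s.
Proof. by move=> hb; apply/tensor_piP => //; rewrite reprK. Qed.

Definition tensor_zero : tensor := \pi_tensor [::].
Definition tensor_add (x y : tensor) : tensor := \pi_tensor (repr x ++ repr y).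
Definition tensor_scale (c : k) (x : tensor) : tensor :=
  \pi_tensor [seq (c *: p.1, p.2) | p <- repr x].
Definition tensor_opp (x : tensor) : tensor := tensor_scale (-1) x.

Lemma formal_sum_cat (W : lmodType k) (phi : U -> V -> W) s t :
  formal_sum phi (s ++ t) = formal_sum phi s + formal_sum phi t.
Proof. by rewrite /formal_sum big_cat. Qed.

Let tensor_ext (x y : tensor) :
  (forall (W : lmodType k) (phi : U -> V -> W),
     bilinear_map phi -> formal_sum phi (repr x) = formal_sum phi (repr y)) ->
  x = y.
Proof. by move=> h; rewrite -[x]reprK -[y]reprK; apply/eqP/tensor_piP. Qed.

Let tE (W : lmodType k) (phi : U -> V -> W) (hb : bilinear_map phi) :=
  (@tensor_repr W phi ^~ hb, formal_sum_cat phi,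
   (fun c s => @formal_sum_scale W phi c s hb)).

Lemma tensor_addA : associative tensor_add.
Proof. by move=> x y z; apply: tensor_ext => W phi hb; rewrite !(tE hb) addrA. Qed.
Lemma tensor_addC : commutative tensor_add.
Proof. by move=> x y; apply: tensor_ext => W phi hb; rewrite !(tE hb) addrC. Qed.
Lemma tensor_add0 : left_id tensor_zero tensor_add.
Proof.
by move=> x; apply: tensor_ext => W phi hb; rewrite !(tE hb) /formal_sum big_nil add0r.
Qed.
Lemma tensor_addN : left_inverse tensor_zero tensor_opp tensor_add.
Proof.
move=> x; apply: tensor_ext => W phi hb.
by rewrite !(tE hb) /formal_sum big_nil scaleN1r addNr.
Qed.
HB.instance Definition _ :=
  GRing.isZmodule.Build tensor tensor_addA tensor_addC tensor_add0 tensor_addN.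

Lemma tensor_scaleA a b x :
  tensor_scale a (tensor_scale b x) = tensor_scale (a * b) x.
Proof. by apply: tensor_ext => W phi hb; rewrite !(tE hb) scalerA. Qed.
Lemma tensor_scale1 : left_id 1 tensor_scale.
Proof. by move=> x; apply: tensor_ext => W phi hb; rewrite !(tE hb) scale1r. Qed.
Lemma tensor_scaleDr : right_distributive tensor_scale +%R.
Proof.
by move=> c x y; apply: tensor_ext => W phi hb; rewrite !(tE hb) scalerDr.
Qed.
Lemma tensor_scaleDl x : {morph tensor_scale^~ x : a b / a + b}.
Proof. by move=> a b; apply: tensor_ext => W phi hb; rewrite !(tE hb) scalerDl. Qed.
HB.instance Definition _ := GRing.Zmodule_isLmodule.Build k tensor
  tensor_scaleA tensor_scale1 tensor_scaleDr tensor_scaleDl.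

Definition tensor_lift (W : lmodType k) (phi : U -> V -> W)
  of bilinear_map phi := fun x : tensor => formal_sum phi (repr x).

Section Lift.
Variables (W : lmodType k) (phi : U -> V -> W) (hb : bilinear_map phi).
Lemma tensor_lift_linear : linear (tensor_lift hb).
Proof. by move=> c x y; rewrite /tensor_lift !(tE hb). Qed.
HB.instance Definition _ :=
  GRing.isLinear.Build k tensor W *:%R (tensor_lift hb) tensor_lift_linear.

Lemma tensor_liftE u v : tensor_lift hb (tpure u v) = phi u v.
Proof. by rewrite /tensor_lift (tE hb) /formal_sum big_seq1. Qed.
End Lift.

Lemma tpure_bilinear : bilinear_map tpure.
Proof.
split=> [v c x y|u c x y]; apply: tensor_ext => W phi hb; rewrite !(tE hb);
  rewrite /formal_sum !big_seq1 /=; case: hb => h1 h2.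
  by rewrite h1.
by rewrite h2.
Qed.

Lemma tensor_sum (x : tensor) : exists s : seq (U * V),
  x = \sum_(p <- s) tpure p.1 p.2.
Proof.
exists (repr x); rewrite -{1}[x]reprK; elim: (repr x) => [|p s IH].
  by rewrite big_nil.
rewrite big_cons -IH; apply: tensor_ext => W phi hb; rewrite !(tE hb).
by rewrite /formal_sum big_cons big_seq1.
Qed.

Lemma tensor_lift_unique (W : lmodType k) (f g : tensor -> W) :
  linear f -> linear g ->
  (forall u v, f (tpure u v) = g (tpure u v)) -> f =1 g.
Proof.
move=> fl gl h x; have [s ->] := tensor_sum x.
have f0 : f 0 = 0.
  by have := fl 1 0 0; rewrite !scale1r addr0 -{1}[f 0]addr0 => /addrI <-.
have g0 : g 0 = 0.
  by have := gl 1 0 0; rewrite !scale1r addr0 -{1}[g 0]addr0 => /addrI <-.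
elim: s => [|p s IH]; first by rewrite !big_nil f0.
rewrite big_cons -[tpure _ _]scale1r fl gl h.
by rewrite IH.
Qed.

End TensorProduct.

(* A B-C-bimodule structure on the k-module M, k acting symmetrically; for
   C = B this is the same thing as a left module structure over B (x) B^op. *)
Record bimod_on (k : comPzRingType) (B C : kAlgType k) (M : lmodType k) :=
    BimodOn {
  lact : B -> M -> M;
  ract : M -> C -> M;
  lact_linear : forall b, linear (lact b);
  lact_linearl : forall m, linear (lact^~ m);
  lact1 : forall m, lact 1 m = m;
  lactM : forall b b' m, lact (b * b') m = lact b (lact b' m);
  ract_linear : forall c, linear (ract^~ c);
  ract_linearr : forall m, linear (ract m);
  ract1 : forall m, ract m 1 = m;
  ractM : forall c c' m, ract m (c * c') = ract (ract m c) c';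
  lractA : forall b m c, ract (lact b m) c = lact b (ract m c)
}.

Record bimodule (k : comPzRingType) (B C : kAlgType k) := Bimodule {
  bimod_sort :> lmodType k;
  bimod_str : bimod_on B C bimod_sort
}.

Record bimod_hom (k : comPzRingType) (B C : kAlgType k)
    (M N : bimodule B C) := BimodHom {
  bhom_fun :> {linear M -> N};
  bhom_lact : forall b m,
    bhom_fun (lact (bimod_str M) b m) = lact (bimod_str N) b (bhom_fun m);
  bhom_ract : forall m c,
    bhom_fun (ract (bimod_str M) m c) = ract (bimod_str N) (bhom_fun m) c
}.

Section BimoduleNotions.
Variables (k : comPzRingType) (B C : kAlgType k).

Definition exact_at (M N P : bimodule B C)
    (f : bimod_hom M N) (g : bimod_hom N P) : Prop :=
  forall y, g y = 0 <-> exists x, f x = y.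

Definition short_exact (M N P : bimodule B C)
    (f : bimod_hom M N) (g : bimod_hom N P) : Prop :=
  [/\ injective f, exact_at f g & forall z, exists y, g y = z].

Definition projective_bimodule (P : bimodule B C) : Prop :=
  forall (M N : bimodule B C) (p : bimod_hom M N) (f : bimod_hom P N),
    (forall y, exists x, p x = y) ->
    exists g : bimod_hom P M, forall z, p (g z) = f z.

Definition fg_bimodule (P : bimodule B C) : Prop :=
  exists (r : nat) (e : 'I_r -> P), forall m : P,
  exists s : seq (B * 'I_r * C),
    m = \sum_(t <- s) lact (bimod_str P) t.1.1 (ract (bimod_str P) (e t.1.2) t.2).

End BimoduleNotions.

Section RegularBimodule.
Variables (k : comPzRingType) (B : kAlgType k).

Lemma kmul_linearr (b : B) : linear (fun x : B => b * x).
Proof. by move=> c x y; rewrite mulrDr kscaleAr. Qed.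
Lemma kmul_linearl (b : B) : linear (fun x : B => x * b).
Proof. by move=> c x y; rewrite mulrDl kscaleAl. Qed.

Definition regular_on : bimod_on B B B :=
  @BimodOn k B B B (fun b m => b * m) (fun m c => m * c) kmul_linearr kmul_linearl (@mul1r B)
    (fun b b' m => esym (mulrA b b' m)) kmul_linearl kmul_linearr (@mulr1 B)
    (fun c c' m => mulrA m c c') (fun b m c => esym (mulrA b m c)).

Definition regular_bimodule : bimodule B B := Bimodule regular_on.

Definition has_fg_projective_resolution : Prop :=
  exists (P : nat -> bimodule B B)
    (d : forall i, bimod_hom (P i.+1) (P i))
    (eps : bimod_hom (P 0%N) regular_bimodule),
  [/\ forall i, projective_bimodule (P i) /\ fg_bimodule (P i),
      forall b, exists x, eps x = b,
      exact_at (d 0%N) eps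
    & forall i, exact_at (d i.+1) (d i)].

End RegularBimodule.

Section Restriction.
Variables (k : comPzRingType) (B C B' C' : kAlgType k) (M : lmodType k).
Variables (f : alg_hom B' B) (g : alg_hom C' C) (s : bimod_on B C M).

Lemma alg_hom_linear (A A' : kAlgType k) (h : alg_hom A A') : linear h.
Proof. by move=> c x y; rewrite rmorphD alg_funZ. Qed.

Definition restrict_bimod : bimod_on B' C' M.
Proof.
refine (@BimodOn k B' C' M (fun b m => lact s (f b) m) (fun m c => ract s m (g c))
  _ _ _ _ _ _ _ _ _).
- by move=> b; apply: lact_linear.
- by move=> m c x y; rewrite alg_hom_linear lact_linearl.
- by move=> m; rewrite rmorph1 lact1.
- by move=> b b' m; rewrite rmorphM lactM.
- by move=> c; apply: ract_linear.
- by move=> m c x y; rewrite alg_hom_linear ract_linearr.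
- by move=> m; rewrite rmorph1 ract1.
- by move=> c c' m; rewrite rmorphM ractM.
- by move=> b m c; rewrite lractA.
Defined.

End Restriction.

Section TensorMap.
Variables (k : comPzRingType) (U V U' V' : lmodType k).
Variables (f : U -> U') (g : V -> V') (fl : linear f) (gl : linear g).

Lemma tmap_bilinear : bilinear_map (fun u v => tpure (f u) (g v)).
Proof.
have [h1 h2] := tpure_bilinear U' V'.
by split=> [v c x y|u c x y] /=; rewrite ?fl ?gl ?h1 ?h2.
Qed.

Definition tmap : tensor U V -> tensor U' V' := tensor_lift tmap_bilinear.

Lemma tmapE u v : tmap (tpure u v) = tpure (f u) (g v).
Proof. exact: tensor_liftE. Qed.

Lemma tmap_linear : linear tmap.
Proof. exact: tensor_lift_linear. Qed.

End TensorMap.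

Section TensorSquare.
Variables (k : comPzRingType) (E : kAlgType k).
Local Notation EE := (tensor E E).

Let idl : linear (@id E). Proof. by []. Qed.

Let comp_linear (U V W : lmodType k) (f : V -> W) (g : U -> V) :
  linear f -> linear g -> linear (fun x => f (g x)).
Proof. by move=> fl gl c x y; rewrite gl fl. Qed.

Let comb_linear (U V : lmodType k) (c : k) (f g : U -> V) :
  linear f -> linear g -> linear (fun x => c *: f x + g x).
Proof.
move=> fl gl d x y; rewrite fl gl !scalerDr !scalerA (mulrC c d) -!addrA.
by congr (_ + _); rewrite addrCA.
Qed.

Let h1 := (tpure_bilinear E E).1.
Let h2 := (tpure_bilinear E E).2.

Local Ltac tmaplin :=
  solve [ exact (tmap_linear (kmul_linearr _) idl)
        | exact (tmap_linear (kmul_linearl _) idl)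
        | exact (tmap_linear idl (kmul_linearr _))
        | exact (tmap_linear idl (kmul_linearl _)) ].

(* a . (m (x) n) . b = a m (x) n b *)
Definition outer_on : bimod_on E E EE.
Proof.
refine (@BimodOn k E E EE (fun a t => tmap (kmul_linearr a) idl t)
  (fun t b => tmap idl (kmul_linearl b) t) _ _ _ _ _ _ _ _ _).
- by move=> a; tmaplin.
- move=> t c a b; move: t; apply: tensor_lift_unique; first tmaplin.
    by apply: comb_linear; tmaplin.
  by move=> u v; rewrite !tmapE mulrDl -kscaleAl h1.
- by apply: tensor_lift_unique; [tmaplin| |move=> u v; rewrite tmapE mul1r].
- move=> a b; apply: tensor_lift_unique; first tmaplin.
    by apply: comp_linear; tmaplin.
  by move=> u v; rewrite !tmapE mulrA.
- by move=> b; tmaplin.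
- move=> t c a b; move: t; apply: tensor_lift_unique; first tmaplin.
    by apply: comb_linear; tmaplin.
  by move=> u v; rewrite !tmapE mulrDr -kscaleAr h2.
- by apply: tensor_lift_unique; [tmaplin| |move=> u v; rewrite tmapE mulr1].
- move=> a b; apply: tensor_lift_unique; first tmaplin.
    by apply: comp_linear; tmaplin.
  by move=> u v; rewrite !tmapE mulrA.
- move=> a t c; move: t; apply: tensor_lift_unique;
    try by apply: comp_linear; tmaplin.
  by move=> u v; rewrite !tmapE.
Defined.

(* a . (m (x) n) . b = m b (x) a n *)
Definition inner_on : bimod_on E E EE.
Proof.
refine (@BimodOn k E E EE (fun a t => tmap idl (kmul_linearr a) t)
  (fun t b => tmap (kmul_linearl b) idl t) _ _ _ _ _ _ _ _ _).
- by move=> a; tmaplin.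
- move=> t c a b; move: t; apply: tensor_lift_unique; first tmaplin.
    by apply: comb_linear; tmaplin.
  by move=> u v; rewrite !tmapE mulrDl -kscaleAl h2.
- by apply: tensor_lift_unique; [tmaplin| |move=> u v; rewrite tmapE mul1r].
- move=> a b; apply: tensor_lift_unique; first tmaplin.
    by apply: comp_linear; tmaplin.
  by move=> u v; rewrite !tmapE mulrA.
- by move=> b; tmaplin.
- move=> t c a b; move: t; apply: tensor_lift_unique; first tmaplin.
    by apply: comb_linear; tmaplin.
  by move=> u v; rewrite !tmapE mulrDr -kscaleAr h1.
- by apply: tensor_lift_unique; [tmaplin| |move=> u v; rewrite tmapE mulr1].
- move=> a b; apply: tensor_lift_unique; first tmaplin.
    by apply: comp_linear; tmaplin.
  by move=> u v; rewrite !tmapE mulrA.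
- move=> a t c; move: t; apply: tensor_lift_unique;
    try by apply: comp_linear; tmaplin.
  by move=> u v; rewrite !tmapE.
Defined.

End TensorSquare.

Section QuotientModule.
Variables (k : comPzRingType) (V : lmodType k) (W : V -> bool).
Variable Wsub : submod_closed W.

Definition submodule_pred (_ : submod_closed W) : V -> bool := W.
HB.instance Definition _ :=
  GRing.isZmodClosed.Build V (submodule_pred Wsub) (GRing.submod_closedB Wsub).

Definition quot_mod : Type := @Quotient.quot V (GRing.ZmodClosed.clone V (submodule_pred Wsub) _).
HB.instance Definition _ := GRing.Zmodule.on quot_mod.
HB.instance Definition _ := EqQuotient.on quot_mod.

Definition qpi (x : V) : quot_mod := \pi_quot_mod x.

Lemma qpiP x y : reflect (qpi x = qpi y) (W (x - y)).
Proof.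
by apply: (iffP idP) => [h|/eqP]; [apply/eqP|]; rewrite -Quotient.idealrBE.
Qed.

Lemma qpi_repr x : qpi (repr x) = x. Proof. exact: reprK. Qed.

Lemma qpiD x y : qpi (x + y) = qpi x + qpi y.
Proof. exact: (@Quotient.pi_add V _). Qed.

Definition quot_scale (c : k) (x : quot_mod) : quot_mod := qpi (c *: repr x).

Lemma quot_scaleE c x : quot_scale c (qpi x) = qpi (c *: x).
Proof.
apply/qpiP; rewrite -scalerBr -[_ *: _]addr0.
by apply: Wsub.2; [apply/qpiP; rewrite qpi_repr|exact: Wsub.1].
Qed.

Lemma quot_scaleA a b x : quot_scale a (quot_scale b x) = quot_scale (a * b) x.
Proof. by rewrite -[x]qpi_repr !quot_scaleE scalerA. Qed.
Lemma quot_scale1 : left_id 1 quot_scale.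
Proof. by move=> x; rewrite -[x]qpi_repr quot_scaleE scale1r. Qed.
Lemma quot_scaleDr : right_distributive quot_scale +%R.
Proof.
move=> c x y; rewrite -[x]qpi_repr -[y]qpi_repr.
by rewrite -qpiD !quot_scaleE -qpiD scalerDr.
Qed.
Lemma quot_scaleDl x : {morph quot_scale^~ x : a b / a + b}.
Proof. by move=> a b; rewrite -[x]qpi_repr !quot_scaleE -qpiD scalerDl. Qed.
HB.instance Definition _ := GRing.Zmodule_isLmodule.Build k quot_mod
  quot_scaleA quot_scale1 quot_scaleDr quot_scaleDl.

Lemma qpi_linear : linear qpi.
Proof. by move=> c x y; rewrite qpiD -quot_scaleE. Qed.

End QuotientModule.

Section Hochschild.
Variables (k : comPzRingType) (B : kAlgType k) (M : lmodType k).
Variable s : bimod_on B B M.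

Definition replace_at n (v : 'I_n -> B) (i : 'I_n) (b : B) : 'I_n -> B :=
  fun j => if j == i then b else v j.

Definition multilinear n (f : ('I_n -> B) -> M) : Prop :=
  forall (v : 'I_n -> B) (i : 'I_n), linear (fun b : B => f (replace_at v i b)).

(* (v_0, .., v_n) |-> (v_0, .., v_j * v_{j+1}, .., v_n) *)
Definition merge_at n (j : 'I_n) (v : 'I_n.+1 -> B) : 'I_n -> B :=
  fun i => if (i < j)%N then v (widen_ord (leqnSn n) i)
           else if i == j then v (widen_ord (leqnSn n) i) * v (lift ord0 i)
           else v (lift ord0 i).

(* k-linear maps on the n-th tensor power of B are represented by multilinear
   maps, so that this is the usual Hochschild cochain complex of B with
   coefficients in M. *)
Definition hdiff n (f : ('I_n -> B) -> M) : ('I_n.+1 -> B) -> M :=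
  fun v =>
    lact s (v ord0) (f (fun i => v (lift ord0 i)))
    + \sum_(j < n) (-1) ^+ j.+1 *: f (merge_at j v)
    + (-1) ^+ n.+1 *: ract s (f (fun i => v (widen_ord (leqnSn n) i))) (v ord_max).

Definition is_cocycle n (f : ('I_n -> B) -> M) : Prop :=
  multilinear f /\ hdiff f = 0.

Definition is_coboundary n : (('I_n -> B) -> M) -> Prop :=
  match n with
  | 0 => fun f => f = 0
  | m.+1 => fun f => exists g : ('I_m -> B) -> M, multilinear g /\ f = hdiff g
  end.

Lemma multilinear0 n : multilinear (0 : ('I_n -> B) -> M).
Proof. by move=> v i c x y; rewrite scaler0 addr0. Qed.

Lemma multilinearP n c (f g : ('I_n -> B) -> M) :
  multilinear f -> multilinear g -> multilinear (c *: f + g).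
Proof.
move=> hf hg v i d x y.
have E u : (c *: f + g) u = c *: f u + g u by [].
rewrite !E hf hg !scalerDr !scalerA (mulrC c d) -!addrA.
by congr (_ + _); rewrite addrCA.
Qed.

Lemma hdiff_linear n : linear (@hdiff n).
Proof.
move=> c f g; apply/funext => v.
have E m (p q : ('I_m -> B) -> M) u : (c *: p + q) u = c *: p u + q u by [].
rewrite E /hdiff !E lact_linear (ract_linear s (v ord_max)).
under eq_bigr do rewrite E scalerDr scalerA mulrC -scalerA.
rewrite big_split /= -scaler_sumr !scalerDr !scalerA (mulrC c) -!addrA.
congr (_ + _); rewrite addrCA; congr (_ + _); rewrite [RHS]addrCA; congr (_ + _).
by rewrite addrCA.
Qed.

Lemma hdiff0 n : hdiff (0 : ('I_n -> B) -> M) = 0.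
Proof.
have := @hdiff_linear n 1 0 0; rewrite !scale1r addr0 -{1}[hdiff 0]addr0.
by move=> /addrI <-.
Qed.

Record cocycle n := Cocycle {
  cocycle_fun :> ('I_n -> B) -> M;
  cocycleP : `[< is_cocycle cocycle_fun >]
}.
HB.instance Definition _ n := [isSub for @cocycle_fun n].
HB.instance Definition _ n := [Choice of cocycle n by <:].

Definition cocycle_pred n (f : ('I_n -> B) -> M) : bool := `[< is_cocycle f >].

Lemma cocycle_submod n : submod_closed (@cocycle_pred n).
Proof.
split; first by apply/asboolP; split; [exact: multilinear0|exact: hdiff0].
move=> c f g /asboolP[fm fd] /asboolP[gm gd]; apply/asboolP.
by split; [exact: multilinearP|rewrite hdiff_linear fd gd scaler0 addr0].
Qed.

HB.instance Definition _ n :=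
  GRing.SubChoice_isSubLmodule.Build k _ (@cocycle_pred n) (cocycle n)
    (GRing.submod_closed_semi (@cocycle_submod n)).

Definition coboundary_pred n (f : cocycle n) : bool := `[< is_coboundary f >].

Lemma cocycle_funP n c (f g : cocycle n) :
  cocycle_fun (c *: f + g) = c *: cocycle_fun f + cocycle_fun g.
Proof. exact: (linearP (\val : cocycle n -> _) c f g). Qed.

Lemma cocycle_funB n (f g : cocycle n) :
  cocycle_fun (f - g) = cocycle_fun f - cocycle_fun g.
Proof. by rewrite addrC -scaleN1r cocycle_funP scaleN1r addrC. Qed.

Lemma is_coboundaryP n c (f g : ('I_n -> B) -> M) :
  is_coboundary f -> is_coboundary g -> is_coboundary (c *: f + g).
Proof.
case: n f g => [|n] f g /=; first by move=> -> ->; rewrite scaler0 addr0.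
move=> [f' [fm ->]] [g' [gm ->]]; exists (c *: f' + g').
by split; [exact: multilinearP|rewrite hdiff_linear].
Qed.

Lemma coboundary_submod n : submod_closed (@coboundary_pred n).
Proof.
split; last first.
  by move=> c f g /asboolP hf /asboolP hg; apply/asboolP; exact: is_coboundaryP.
apply/asboolP; case: n => [|n] //=; exists 0.
by split; [exact: multilinear0|rewrite hdiff0].
Qed.

Definition HH n : lmodType k := quot_mod (@coboundary_submod n).

Definition hclass n (f : cocycle n) : HH n := qpi (@coboundary_submod n) f.

Lemma hclassP n (f g : cocycle n) :
  hclass f = hclass g <-> is_coboundary (f - g).
Proof. by split=> [/qpiP/asboolP //|h]; apply/qpiP/asboolP. Qed.

Lemma HH_ext n (f g : cocycle n) :
  (forall v, f v = g v) -> hclass f = hclass g.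
Proof. by move=> h; congr hclass; apply/val_inj/funext. Qed.

Lemma hclass_repr n (x : HH n) : hclass (repr x) = x.
Proof. exact: qpi_repr. Qed.

Lemma hclass_linear n : linear (@hclass n).
Proof. exact: qpi_linear. Qed.

End Hochschild.

(* A B-B-bimodule endomorphism of M acts on H^n(B, M) by composition. *)
Section Functoriality.
Variables (k : comPzRingType) (B : kAlgType k) (M : lmodType k).
Variable s : bimod_on B B M.

Definition bimod_endo (phi : M -> M) : Prop :=
  [/\ linear phi, forall b m, phi (lact s b m) = lact s b (phi m)
    & forall m b, phi (ract s m b) = ract s (phi m) b].

Variables (phi : M -> M) (hphi : bimod_endo phi).

Let phiZ c m : phi (c *: m) = c *: phi m.
Proof.
have [h _ _] := hphi; have h0 : phi 0 = 0.
  by have := h 1 0 0; rewrite !scale1r addr0 -{1}[phi 0]addr0 => /addrI <-.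
by rewrite -[c *: m]addr0 h h0 addr0.
Qed.

Let phiD m m' : phi (m + m') = phi m + phi m'.
Proof. by have [h _ _] := hphi; rewrite -[m]scale1r h !scale1r. Qed.

Lemma endo_multilinear n (f : ('I_n -> B) -> M) :
  multilinear f -> multilinear (phi \o f).
Proof. by move=> hf v i c x y; rewrite /= hf phiD phiZ. Qed.

Lemma endo_hdiff n (f : ('I_n -> B) -> M) :
  hdiff s (phi \o f) = phi \o hdiff s f.
Proof.
have [_ hl hr] := hphi; apply/funext => v; rewrite /hdiff /= !phiD phiZ hl hr.
congr (_ + _ + _); have phi0 : phi 0 = 0 by rewrite -(scale0r 0) phiZ !scale0r.
by rewrite (big_morph phi phiD phi0); apply: eq_bigr => j _; rewrite phiZ.
Qed.

Lemma endo_coboundary n (f : ('I_n -> B) -> M) :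
  is_coboundary s f -> is_coboundary s (phi \o f).
Proof.
case: n f => [|n] f /= => [->|[g [gm ->]]]; last first.
  by exists (phi \o g); rewrite endo_hdiff; split=> //; exact: endo_multilinear.
by apply/funext => v /=; have := phiZ 0 0; rewrite !scale0r.
Qed.

Lemma endo_cocycle n (f : cocycle s n) :
  `[< is_cocycle s (phi \o f) >].
Proof.
case: f => f /= /asboolP[fm fd]; apply/asboolP; split.
  exact: endo_multilinear.
rewrite endo_hdiff fd; apply/funext => v /=.
by have := phiZ 0 0; rewrite !scale0r.
Qed.

Definition cocycle_map n (f : cocycle s n) : cocycle s n :=
  Cocycle (endo_cocycle f).

Definition HH_map n (x : HH s n) : HH s n := hclass (cocycle_map (repr x)).

Lemma HH_mapE n (f : cocycle s n) : HH_map (hclass f) = hclass (cocycle_map f).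
Proof.
apply/hclassP; have /hclassP : hclass (repr (hclass f)) = hclass f by exact: hclass_repr.
rewrite !cocycle_funB /=; move: (repr _) => g h.
have -> : (phi \o g) - (phi \o f) = phi \o (g - f : ('I_n -> B) -> M).
  apply/funext => v; change (phi (g v) - phi (f v) = phi (g v - f v)).
  by rewrite phiD -[- f v]scaleN1r phiZ scaleN1r.
exact: endo_coboundary.
Qed.

Lemma HH_map_linear n : linear (@HH_map n).
Proof.
move=> c x y; rewrite -[x]hclass_repr -[y]hclass_repr.
rewrite -hclass_linear !HH_mapE -hclass_linear.
apply: HH_ext => v; rewrite cocycle_funP.
set f := repr x; set g := repr y.
change (phi (cocycle_fun (c *: f + g) v) = c *: phi (f v) + phi (g v)).
by rewrite cocycle_funP -phiZ -phiD.
Qed.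

End Functoriality.

Section BimoduleOnCohomology.
Variables (k : comPzRingType) (B C D : kAlgType k) (M : lmodType k).
Variables (s : bimod_on B B M) (t : bimod_on C D M).

Definition bimod_commute : Prop :=
  (forall c, bimod_endo s (lact t c)) /\ (forall d, bimod_endo s ((ract t)^~ d)).

Hypothesis st : bimod_commute.

Definition HH_on n : bimod_on C D (HH s n).
Proof.
refine (@BimodOn k C D (HH s n) (fun c => @HH_map _ _ _ _ _ (st.1 c) n)
  (fun x d => @HH_map _ _ _ _ _ (st.2 d) n x) _ _ _ _ _ _ _ _ _).
- by move=> c; exact: HH_map_linear.
- move=> x c a b; rewrite -[x]hclass_repr !HH_mapE -hclass_linear.
  by apply: HH_ext => v; rewrite cocycle_funP /= lact_linearl.
- by move=> x; rewrite -[x]hclass_repr HH_mapE; apply: HH_ext => v /=; rewrite lact1.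
- move=> c c' x; rewrite -[x]hclass_repr !HH_mapE.
  by apply: HH_ext => v /=; rewrite lactM.
- by move=> d; exact: HH_map_linear.
- move=> x c a b; rewrite -[x]hclass_repr !HH_mapE -hclass_linear.
  by apply: HH_ext => v; rewrite cocycle_funP /= ract_linearr.
- by move=> x; rewrite -[x]hclass_repr HH_mapE; apply: HH_ext => v /=; rewrite ract1.
- move=> c c' x; rewrite -[x]hclass_repr !HH_mapE.
  by apply: HH_ext => v /=; rewrite ractM.
- move=> c x d; rewrite -[x]hclass_repr !HH_mapE.
  by apply: HH_ext => v /=; rewrite lractA.
Defined.

Definition HH_bimodule n : bimodule C D := Bimodule (HH_on n).

End BimoduleOnCohomology.

Lemma restrict_commute (k : comPzRingType) (B B' C D : kAlgType k)
    (M : lmodType k) (f g : alg_hom B' B) (s : bimod_on B B M)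
    (t : bimod_on C D M) :
  bimod_commute s t -> bimod_commute (restrict_bimod f g s) t.
Proof.
by case=> h1 h2; split=> [c|d]; [have [p q r] := h1 c|have [p q r] := h2 d];
  split=> // *; [apply: q|apply: r|apply: q|apply: r].
Qed.

Section ActionsOnPureTensors.
Variables (k : comPzRingType) (E : kAlgType k).
Implicit Types a b m n : E.

Lemma outer_lactE a m n : lact (outer_on E) a (tpure m n) = tpure (a * m) n.
Proof. exact: tmapE. Qed.
Lemma outer_ractE b m n : ract (outer_on E) (tpure m n) b = tpure m (n * b).
Proof. exact: tmapE. Qed.
Lemma inner_lactE a m n : lact (inner_on E) a (tpure m n) = tpure m (a * n).
Proof. exact: tmapE. Qed.
Lemma inner_ractE b m n : ract (inner_on E) (tpure m n) b = tpure (m * b) n.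
Proof. exact: tmapE. Qed.

Lemma outer_inner_commute : bimod_commute (outer_on E) (inner_on E).
Proof.
have comp (f g : tensor E E -> tensor E E) :
    linear f -> linear g -> linear (fun x => f (g x)).
  by move=> fl gl c x y; rewrite gl fl.
have ol := lact_linear (outer_on E); have orr := ract_linear (outer_on E).
have il := lact_linear (inner_on E); have ir := ract_linear (inner_on E).
split=> c; split=> [|b|t b]; [exact: il| | |exact: ir| |].
- apply: tensor_lift_unique; [exact: comp|exact: comp|move=> m n].
  by rewrite !(outer_lactE, inner_lactE).
- move: t; apply: tensor_lift_unique.
  + exact: (comp _ _ (il c) (orr b)).
  + exact: (comp _ _ (orr b) (il c)).
  by move=> m n; rewrite !(outer_ractE, inner_lactE) mulrA.
- apply: tensor_lift_unique.
  + exact: (comp _ _ (ir c) (ol b)).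
  + exact: (comp _ _ (ol b) (ir c)).
  by move=> m n; rewrite !(outer_lactE, inner_ractE) mulrA.
- move: t; apply: tensor_lift_unique.
  + exact: (comp _ _ (ir c) (orr b)).
  + exact: (comp _ _ (orr b) (ir c)).
  by move=> m n; rewrite !(outer_ractE, inner_ractE).
Qed.

End ActionsOnPureTensors.

Section CohomologyOfOreExtensions.
Variables (k : comPzRingType) (A : kAlgType k) (sigma : alg_aut A).
Variables (delta : skew_derivation sigma) (E : ore_extension delta).

Lemma alg_comp_scalable (B C D : kAlgType k) (g : alg_hom C D) (f : alg_hom B C) :
  scalable (g \o f : {rmorphism B -> D}).
Proof. by move=> c x /=; rewrite !alg_funZ. Qed.

Definition alg_comp (B C D : kAlgType k) (g : alg_hom C D) (f : alg_hom B C) :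
  alg_hom B D := AlgHom (alg_comp_scalable g f).

(* E (x) E as an A-bimodule: a . (m (x) n) . b = a m (x) n b *)
Definition EE_on : bimod_on A A (tensor E E) :=
  restrict_bimod (ore_incl E) (ore_incl E) (outer_on E).

(* E (x) E^(sigma^-1): a . (m (x) n) . b = a m (x) n sigma^-1(b) *)
Definition EEtwist_on : bimod_on A A (tensor E E) :=
  restrict_bimod (ore_incl E) (alg_comp (ore_incl E) (aut_inv sigma)) (outer_on E).

Lemma EE_commute : bimod_commute EE_on (inner_on E).
Proof. exact: restrict_commute (outer_inner_commute E). Qed.

Lemma EEtwist_commute : bimod_commute EEtwist_on (inner_on E).
Proof. exact: restrict_commute (outer_inner_commute E). Qed.

End CohomologyOfOreExtensions.

(* Main.v *)
Require Import Defs.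
From HB Require Import structures.
From mathcomp Require Import all_boot all_algebra.
From mathcomp Require Import boolp functions.

Set Implicit Arguments.
Unset Strict Implicit.
Unset Printing Implicit Defensive.

Import GRing.Theory.
Local Open Scope ring_scope.

(** Write x for the variable of E.  Since E is free over A on the powers of x,
    the E-bimodule E is the cokernel of an injective map E' (x)_A E -> E (x)_A E
    which sends 1 (x) 1 to x (x) 1 - 1 (x) x, where A acts on the right of E'
    through sigma.  Let sM be an E-bimodule M seen as an A-bimodule with left
    action through sigma.  Then H(E, M) is the cohomology of the cone of a map
    from the cochains of A in M to those in sM, the commutator with x, and
    there is a long exact sequence

      H^n(A, M) -> H^n(A, sM) -> H^{n+1}(E, M) -> H^{n+1}(A, M) -> ...

    For M = E (x) E the first map is injective in every degree, so the long
    sequence breaks into the short ones of the theorem: f is the commutator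
    with x and g the connecting map.  The module sM is isomorphic to the one in
    the theorem, which is twisted by the inverse of sigma on the right: pull
    cochains back along sigma.

    The commutator with x on cochains is [var_comm]; it needs one correction
    term with delta in each slot ([var_comm_hdiff]).  The map from the cochains
    of E to the cone sends F to its restriction to A together with
    [var_slots F], the alternating sum of the insertions of x into the slots of
    F ([var_slots_hdiff]).  Both identities are proved by induction on the
    degree, by Hochschild's identification of C^{n+1}(B, M) with
    C^n(B, Hom(B, M)).

    This map to the cone is a quasi-isomorphism ([comparison_inj],
    [comparison_surj]) by dimension shifting along
    0 -> M -> Hom(E, M) -> M' -> 0, where the middle term is coinduced.  Its
    cohomology over E vanishes in positive degrees, and so does the cohomology
    of its cone over A, because E is a free left A-module
    ([coind_cone_acyclic]).

    Injectivity for M = E (x) E ([var_comm_inj]) is a comparison of leading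
    coefficients: left multiplication by x raises the degree in x of the left
    factor by one, and the other terms of the commutator do not raise it.  This
    argument needs cocycles whose values have bounded degree.  They represent
    all classes because A has a resolution by finitely generated projectives:
    a cocycle is cohomologous to one that factors through such a module, so its
    values lie in a finitely generated sub-bimodule ([fg_cocycle]). *)

(** * Identities in abelian groups *)

(** Reified sums for the tactic [abelian], which decides for abelian groups what
    [ring] decides for commutative rings. *)
Inductive zexp := ZZero | ZVar of nat | ZAdd of zexp & zexp | ZOpp of zexp.

Fixpoint zeval (V : zmodType) (env : seq V) (e : zexp) : V :=
  match e with
  | ZZero => 0
  | ZVar i => nth 0 env i
  | ZAdd a b => zeval env a + zeval env b
  | ZOpp a => - zeval env a
  end.

Fixpoint zcoef (e : zexp) (i : nat) : int :=
  match e with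
  | ZZero => 0
  | ZVar j => if j == i then 1 else 0
  | ZAdd a b => zcoef a i + zcoef b i
  | ZOpp a => - zcoef a i
  end.

Lemma zevalE (V : zmodType) (env : seq V) e :
  zeval env e = \sum_(i < size env) nth 0 env i *~ zcoef e i.
Proof.
elim: e => [|j|a IHa b IHb|a IHa] /=.
- by rewrite big1 // => i _; rewrite mulr0z.
- have [lt|ge] := ltnP j (size env); last first.
    rewrite nth_default // big1 // => i _.
    by case: eqP => [e|]; rewrite ?mulr0z //; move: ge; rewrite e leqNgt ltn_ord.
  rewrite (bigD1 (Ordinal lt)) //= eqxx mulr1z big1 ?addr0 // => i.
  by rewrite -val_eqE eq_sym /= => /negPf ->; rewrite mulr0z.
- by rewrite IHa IHb -big_split /=; apply: eq_bigr => i _; rewrite mulrzDr.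
- by rewrite IHa -sumrN; apply: eq_bigr => i _; rewrite mulrNz.
Qed.

Lemma zeval_eq (V : zmodType) (env : seq V) e1 e2 :
  all (fun i => zcoef e1 i == zcoef e2 i) (iota 0 (size env)) ->
  zeval env e1 = zeval env e2.
Proof.
move=> /allP h; rewrite !zevalE; apply: eq_bigr => i _.
by rewrite (eqP (h i _)) // mem_iota /= add0n.
Qed.

(* Atoms are compared up to conversion, since equal terms may carry different
   instance paths. *)
Ltac zindex x l :=
  match l with
  | cons ?y _ => let _ := match goal with _ => unify x y end in constr:(0%N)
  | cons _ ?l' => let i := zindex x l' in constr:(S i)
  end.
Ltac zinsert T x l :=
  match goal with
  | _ => let i := zindex x l in l
  | _ => constr:(@cons T x l)
  end.
Ltac zatoms V t l :=
  lazymatch t with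
  | GRing.add ?a ?b => let l1 := zatoms V a l in zatoms V b l1
  | GRing.opp ?a => zatoms V a l
  | GRing.zero => l
  | _ => zinsert V t l
  end.
Ltac zreify t l :=
  lazymatch t with
  | GRing.add ?a ?b =>
      let a' := zreify a l in let b' := zreify b l in constr:(ZAdd a' b')
  | GRing.opp ?a => let a' := zreify a l in constr:(ZOpp a')
  | GRing.zero => constr:(ZZero)
  | _ => let i := zindex t l in constr:(ZVar i)
  end.
Ltac abelian :=
  cbv beta; lazymatch goal with
  | |- @eq ?T ?a ?b =>
      let l := zatoms T a (@nil T) in
      let l := zatoms T b l in
      let a' := zreify a l in let b' := zreify b l in
      refine (@zeval_eq _ l a' b' _); exact: isT
  end.

(** * Hochschild cochains and their last argument *)

Section LastSlot.
Variable T : Type.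

Definition vinit n (w : 'I_n.+1 -> T) : 'I_n -> T :=
  fun i => w (widen_ord (leqnSn n) i).

Definition vtail n (w : 'I_n.+1 -> T) : 'I_n -> T := fun i => w (lift ord0 i).

(** Built from [unlift] rather than from a test on values so that it computes
    on [lift ord_max i] and [ord_max], the two shapes that [unliftP] yields. *)
Definition vrcons n (v : 'I_n -> T) (c : T) : 'I_n.+1 -> T :=
  fun i => oapp v c (unlift ord_max i).

Lemma lift_max_widen n (i : 'I_n) : lift ord_max i = widen_ord (leqnSn n) i.
Proof. by apply: val_inj; rewrite /= /bump leqNgt ltn_ord. Qed.

Lemma vrcons_max n (v : 'I_n -> T) c : vrcons v c ord_max = c.
Proof. by rewrite /vrcons unlift_none. Qed.

Lemma vrcons_widen n (v : 'I_n -> T) c i :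
  vrcons v c (widen_ord (leqnSn n) i) = v i.
Proof. by rewrite -lift_max_widen /vrcons liftK. Qed.

Lemma vinit_vrcons n (v : 'I_n -> T) c : vinit (vrcons v c) = v.
Proof. by apply/funext => i; rewrite /vinit vrcons_widen. Qed.

Lemma vrcons_eta n (w : 'I_n.+1 -> T) : vrcons (vinit w) (w ord_max) = w.
Proof.
apply/funext => i; case: (unliftP ord_max i) => [j|] ->; last by rewrite vrcons_max.
by rewrite lift_max_widen vrcons_widen.
Qed.

Lemma vrcons_ext n (w w' : 'I_n.+1 -> T) :
  vinit w = vinit w' -> w ord_max = w' ord_max -> w = w'.
Proof. by move=> e e'; rewrite -[w]vrcons_eta e e' vrcons_eta. Qed.

Lemma vrcons0 n (v : 'I_n.+1 -> T) c : vrcons v c ord0 = v ord0.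
Proof. by rewrite -[RHS](vrcons_widen v c); congr vrcons; apply: val_inj. Qed.

Lemma vtail_vrcons n (v : 'I_n.+1 -> T) c :
  vtail (vrcons v c) = vrcons (vtail v) c.
Proof.
apply: vrcons_ext; last first.
  by rewrite vrcons_max -[RHS](vrcons_max v); congr vrcons; apply: val_inj.
rewrite vinit_vrcons; apply/funext => i; rewrite /vinit /vtail.
by rewrite -[RHS](vrcons_widen v c); congr vrcons; apply: val_inj.
Qed.

Lemma vec0 (v w : 'I_0 -> T) : v = w.
Proof. by apply/funext => -[]. Qed.

End LastSlot.

Lemma vrcons_comp T U (g : T -> U) n (v : 'I_n -> T) c :
  g \o vrcons v c = vrcons (g \o v) (g c).
Proof.
apply: vrcons_ext; last by rewrite /= !vrcons_max.
by rewrite vinit_vrcons; apply/funext => i; rewrite /vinit /= vrcons_widen.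
Qed.

Section MergeLast.
Variables (k : comPzRingType) (B : kAlgType k).

Lemma merge_at_vrcons n (j : 'I_n) (v : 'I_n.+1 -> B) c :
  merge_at (widen_ord (leqnSn n) j) (vrcons v c) = vrcons (merge_at j v) c.
Proof.
have vr (i : 'I_n.+1) : vrcons v c (widen_ord (leqnSn n.+1) i) = v i.
  exact: vrcons_widen.
apply: vrcons_ext; last first.
  rewrite vrcons_max /merge_at /= ltnNge ltnW //= -val_eqE /= gtn_eqF //.
  by rewrite -[RHS](vrcons_max v); congr vrcons; apply: val_inj.
rewrite vinit_vrcons; apply/funext => i; rewrite /vinit /merge_at /= -val_eqE /= vr.
have -> : lift ord0 (widen_ord (leqnSn n) i) = widen_ord (leqnSn n.+1) (lift ord0 i).
  exact: val_inj.
by rewrite vr.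
Qed.

(** Only the last merge sees the new entry; this is the term that turns into
    the right action after currying. *)
Lemma merge_at_max n (v : 'I_n.+1 -> B) c :
  merge_at ord_max (vrcons v c) = vrcons (vinit v) (v ord_max * c).
Proof.
have vr (i : 'I_n.+1) : vrcons v c (widen_ord (leqnSn n.+1) i) = v i.
  exact: vrcons_widen.
apply: vrcons_ext; last first.
  rewrite vrcons_max /merge_at /= ltnn eqxx vr; congr (_ * _).
  by rewrite -[RHS](vrcons_max v); congr vrcons; apply: val_inj.
by rewrite vinit_vrcons; apply/funext => i; rewrite /vinit /merge_at /= ltn_ord vr.
Qed.

End MergeLast.

Section RawDifferential.
Variables (k : comPzRingType) (B : kAlgType k).

(** The Hochschild differential for two operations without axioms.  Currying
    the last argument replaces a bimodule by one that is not unital, and whose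
    right operation is linear in the scalar on linear functions only, so that
    the inductions below cannot stay inside [bimod_on]. *)
Definition rdiff (M : lmodType k) (l : B -> M -> M) (r : M -> B -> M) n
    (f : ('I_n -> B) -> M) : ('I_n.+1 -> B) -> M :=
  fun v => l (v ord0) (f (vtail v))
    + \sum_(j < n) (-1) ^+ j.+1 *: f (merge_at j v)
    + (-1) ^+ n.+1 *: r (f (vinit v)) (v ord_max).

Lemma hdiffE (M : lmodType k) (s : bimod_on B B M) n (f : ('I_n -> B) -> M) :
  hdiff s f = rdiff (lact s) (ract s) f.
Proof. by []. Qed.

Definition curry (T : Type) (M : Type) n (f : ('I_n.+1 -> T) -> M) : ('I_n -> T) -> T -> M :=
  fun v c => f (vrcons v c).

Definition curry_l (M : lmodType k) (l : B -> M -> M) : B -> (B -> M) -> (B -> M) :=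
  fun b phi c => l b (phi c).

(** Hochschild's right action on functions.  The second term absorbs the last
    term of the differential, and makes the action non-unital. *)
Definition curry_r (M : lmodType k) (r : M -> B -> M) : (B -> M) -> B -> (B -> M) :=
  fun phi b c => phi (b * c) - r (phi b) c.

(** Hochschild's dimension shift at the level of cochains: currying the last
    argument commutes with the differential, with no sign. *)
Lemma rdiff_vrcons (M : lmodType k) (l : B -> M -> M) (r : M -> B -> M) n
    (f : ('I_n.+1 -> B) -> M) v c :
  rdiff l r f (vrcons v c) = rdiff (curry_l l) (curry_r r) (curry f) v c.
Proof.
rewrite /rdiff vrcons0 vtail_vrcons vinit_vrcons vrcons_max big_ord_recr /= merge_at_max.
rewrite !fctE fct_sumE /= /curry_l /curry_r /curry -!addrA; congr (_ + (_ + _)).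
  by apply: eq_bigr => j _; rewrite merge_at_vrcons.
by rewrite vrcons_eta scalerBr [(-1) ^+ n.+2]exprS mulN1r scaleNr.
Qed.

(** What survives of the bimodule axioms under currying. *)
Record pre_bimod (M : lmodType k) (l : B -> M -> M) (r : M -> B -> M) : Prop := PreBimod {
  pre_ll : forall b, linear (l b);
  pre_rl : forall b, linear (r^~ b);
  pre_lM : forall b b' m, l (b * b') m = l b (l b' m);
  pre_rM : forall b b' m, r m (b * b') = r (r m b) b';
  pre_lr : forall b m c, r (l b m) c = l b (r m c)
}.

Lemma bimod_pre (M : lmodType k) (s : bimod_on B B M) : pre_bimod (lact s) (ract s).
Proof.
split.
- exact: lact_linear.
- exact: ract_linear.
- exact: lactM.
- exact: ractM.
- exact: lractA.
Qed.

End RawDifferential.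

Section LinearFacts.
Variables (k : comPzRingType) (U V : lmodType k) (f : U -> V).
Hypothesis fl : linear f.
Lemma lin0 : f 0 = 0.
Proof. by have := fl 1 0 0; rewrite !scale1r addr0 -{1}[f 0]addr0 => /addrI <-. Qed.
Lemma linD x y : f (x + y) = f x + f y.
Proof. by rewrite -[x]scale1r fl !scale1r. Qed.
Lemma linZ c x : f (c *: x) = c *: f x.
Proof. by rewrite -[c *: x]addr0 fl lin0 addr0. Qed.
Lemma linN x : f (- x) = - f x.
Proof. by rewrite -!scaleN1r linZ. Qed.
Lemma linB x y : f (x - y) = f x - f y.
Proof. by rewrite linD linN. Qed.
Lemma lin_sum I (s : seq I) (P : pred I) (F : I -> U) :
  f (\sum_(i <- s | P i) F i) = \sum_(i <- s | P i) f (F i).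
Proof. exact: (big_morph f linD lin0). Qed.
End LinearFacts.

Section CurriedBimodule.
Variables (k : comPzRingType) (B : kAlgType k) (M : lmodType k).
Variables (l : B -> M -> M) (r : M -> B -> M).
Hypothesis lr : pre_bimod l r.

Lemma curry_pre : pre_bimod (curry_l l) (curry_r r).
Proof.
have [ll rl lM rM lrA] := lr; split.
- by move=> b c f g; apply/funext => e; rewrite /curry_l !fctE ll.
- move=> b c f g; apply/funext => e; rewrite /curry_r !fctE rl scalerBr.
  by rewrite opprD !addrA; congr (_ + _); rewrite -!addrA; congr (_ + _); rewrite addrC.
- by move=> b b' f; apply/funext => e; rewrite /curry_l lM.
- move=> b b' f; apply/funext => e; rewrite /curry_r (linB (rl _)) -rM mulrA.
  by rewrite opprB addrA addrNK.
- by move=> b f c; apply/funext => e; rewrite /curry_l /curry_r (linB (ll b)) lrA.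
Qed.

End CurriedBimodule.

Section SquareZero.
Variables (k : comPzRingType) (B : kAlgType k).

Lemma rdiff_arity0 (M : lmodType k) (l : B -> M -> M) (r : M -> B -> M)
    (f : ('I_0 -> B) -> M) v u :
  rdiff l r f v = l (v ord_max) (f u) - r (f u) (v ord_max).
Proof.
rewrite /rdiff big_ord0 addr0 expr1 scaleN1r (vec0 (vtail v) u) (vec0 (vinit v) u).
by congr (l (v _) _ - _); apply: val_inj.
Qed.

Lemma curry_rdiff n (M : lmodType k) (l : B -> M -> M) (r : M -> B -> M)
    (f : ('I_n.+1 -> B) -> M) :
  curry (rdiff l r f) = rdiff (curry_l l) (curry_r r) (curry f).
Proof. by apply/funext => w; apply/funext => c; rewrite /curry rdiff_vrcons. Qed.

(** Currying reduces the claim in degree n+1 to degree n for the functions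
    from B to M, so only the computation in degree 0 is left. *)
Lemma rdiff_rdiff n (M : lmodType k) (l : B -> M -> M) (r : M -> B -> M)
  (f : ('I_n -> B) -> M) : pre_bimod l r -> rdiff l r (rdiff l r f) = 0.
Proof.
elim: n M l r f => [|n IH] M l r f lr; apply/funext => v; rewrite -[v]vrcons_eta; last first.
  by rewrite rdiff_vrcons curry_rdiff IH //; exact: curry_pre.
pose u : 'I_0 -> B := vinit (vinit v); have [ll rl lM rM lrA] := lr.
rewrite rdiff_vrcons (rdiff_arity0 _ _ _ _ u) /curry_l /curry_r /curry !fctE.
rewrite !(rdiff_arity0 _ _ _ _ u) !vrcons_max (linB (ll _)) (linB (rl _)).
rewrite lM rM lrA -[RHS]/(0 : M). abelian.
Qed.

End SquareZero.

Section Naturality.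
Variables (k : comPzRingType) (B C : kAlgType k) (M N : lmodType k).
Variables (g : C -> B) (phi : M -> N).
Hypotheses (gM : {morph g : a b / a * b}) (phil : linear phi).
Variables (l : B -> M -> M) (r : M -> B -> M) (l' : C -> N -> N) (r' : N -> C -> N).
Hypotheses (phi_l : forall c m, phi (l (g c) m) = l' c (phi m))
  (phi_r : forall m c, phi (r m (g c)) = r' (phi m) c).

Lemma merge_at_comp n (j : 'I_n) (v : 'I_n.+1 -> C) :
  merge_at j (g \o v) = g \o merge_at j v.
Proof. by apply/funext => i; rewrite /merge_at /=; do 2![case: ifP => // _]. Qed.

(** Change of algebra and of coefficients at once: it serves for restriction
    to A, for the twist by sigma and for maps of bimodules. *)
Lemma rdiff_natural n (f : ('I_n -> B) -> M) :
  rdiff l' r' (fun v => phi (f (g \o v))) = fun v => phi (rdiff l r f (g \o v)).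
Proof.
apply/funext => v; rewrite /rdiff !(linD phil) (lin_sum phil) (linZ phil) /= phi_l phi_r.
by congr (_ + _ + _); apply: eq_bigr => j _; rewrite linZ // merge_at_comp.
Qed.

End Naturality.

Section DifferentialLinear.
Variables (k : comPzRingType) (B : kAlgType k) (M : lmodType k).
Variables (l : B -> M -> M) (r : M -> B -> M).
Hypothesis lr : pre_bimod l r.

Lemma rdiff_linear n : linear (@rdiff k B M l r n).
Proof.
have [ll rl _ _ _] := lr.
move=> c f g; apply/funext => v; rewrite /rdiff !fctE ll rl.
under eq_bigr do rewrite scalerDr scalerA mulrC -scalerA.
rewrite big_split /= -scaler_sumr !scalerDr !scalerA (mulrC c); abelian.
Qed.

End DifferentialLinear.

Section Multilinear.
Variables (k : comPzRingType).

Lemma replace_at_vrcons_max (B : Type) n (v : 'I_n -> B) c b :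
  (fun j => if j == ord_max then b else vrcons v c j) = vrcons v b.
Proof.
apply: vrcons_ext; last by rewrite eqxx vrcons_max.
rewrite vinit_vrcons; apply/funext => i; rewrite /vinit -val_eqE /= ltn_eqF //.
exact: vrcons_widen.
Qed.

Lemma replace_at_vrcons_widen (B : Type) n (v : 'I_n -> B) c (i : 'I_n) b :
  (fun j => if j == widen_ord (leqnSn n) i then b else vrcons v c j) =
  vrcons (fun j => if j == i then b else v j) c.
Proof.
apply: vrcons_ext; last by rewrite !vrcons_max -val_eqE /= gtn_eqF.
rewrite vinit_vrcons; apply/funext => j; rewrite /vinit -val_eqE /= val_eqE.
by case: ifP => // _; exact: vrcons_widen.
Qed.

(** Linearity in the last argument is kept apart because the functions from B
    to M are not assumed linear. *)
Lemma multilinear_curry (B : kAlgType k) (M : lmodType k) n (f : ('I_n.+1 -> B) -> M) :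
  multilinear f <-> multilinear (curry f : _ -> B -> M) /\ forall v, linear (curry f v).
Proof.
split=> [fm|[cm cl] v i].
  split=> [v i c x y|v c x y].
    apply/funext => e; have := fm (vrcons v e) (widen_ord (leqnSn n) i) c x y.
    by rewrite /replace_at !replace_at_vrcons_widen.
  by have := fm (vrcons v 0) ord_max c x y; rewrite /replace_at !replace_at_vrcons_max.
rewrite -[v]vrcons_eta; case: (unliftP ord_max i) => [j|] -> c x y; last first.
  rewrite /replace_at !replace_at_vrcons_max; exact: cl.
rewrite lift_max_widen /replace_at !replace_at_vrcons_widen.
exact: (congr1 (fun h => h (v ord_max)) (cm (vinit v) j c x y)).
Qed.

Lemma multilinear_comp (B C : kAlgType k) (M N : lmodType k) n (g : 'I_n -> C -> B)
    (phi : M -> N) (f : ('I_n -> B) -> M) :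
  linear phi -> (forall i, linear (g i)) -> multilinear f ->
  multilinear (fun v => phi (f (fun i => g i (v i)))).
Proof.
move=> phil gl fm v i c x y.
have E b : (fun j => g j (replace_at v i b j)) =
    replace_at (fun j => g j (v j)) i (g i b).
  by apply/funext => j; rewrite /replace_at; case: eqP => [->|].
by rewrite !E gl fm phil.
Qed.

Lemma multilinear_post (B : kAlgType k) (M N : lmodType k) n
    (phi : M -> N) (f : ('I_n -> B) -> M) :
  linear phi -> multilinear f -> multilinear (phi \o f).
Proof.
by move=> h fm; apply: (multilinear_comp (g := fun _ b => b) h _ fm).
Qed.

Lemma multilinear_add (B : kAlgType k) (M : lmodType k) n (f g : ('I_n -> B) -> M) :
  multilinear f -> multilinear g -> multilinear (f + g).
Proof. by move=> hf hg; rewrite -[f]scale1r; exact: multilinearP. Qed.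

Lemma multilinear_scale (B : kAlgType k) (M : lmodType k) n c (f : ('I_n -> B) -> M) :
  multilinear f -> multilinear (c *: f).
Proof.
by move=> hf; rewrite -[_ *: _]addr0; apply: multilinearP => //; exact: multilinear0.
Qed.

Lemma multilinear_opp (B : kAlgType k) (M : lmodType k) n (f : ('I_n -> B) -> M) :
  multilinear f -> multilinear (- f).
Proof. by rewrite -scaleN1r; exact: multilinear_scale. Qed.

Lemma multilinear_sum (B : kAlgType k) (M : lmodType k) n m (F : 'I_m -> ('I_n -> B) -> M) :
  (forall i, multilinear (F i)) -> multilinear (\sum_i F i).
Proof.
move=> h; elim/big_rec: _ => [|i f _ hf]; first exact: multilinear0.
exact: multilinear_add.
Qed.

(** The predicate W makes the induction possible: after currying, the right
    action is linear in the scalar only on linear functions, so W becomes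
    linearity together with W on all values. *)
Lemma rdiff_multilinear_in n (B : kAlgType k) (M : lmodType k) (l : B -> M -> M) (r : M -> B -> M)
    (W : M -> Prop) (f : ('I_n -> B) -> M) :
  pre_bimod l r ->
  (forall c x y, W x -> W y -> W (c *: x + y)) ->
  (forall b m, W m -> W (l b m)) -> (forall m b, W m -> W (r m b)) ->
  (forall m, W m -> linear (l^~ m)) -> (forall m, W m -> linear (r m)) ->
  (forall v, W (f v)) -> multilinear f ->
  multilinear (rdiff l r f) /\ (forall v, W (rdiff l r f v)).
Proof.
elim: n M l r W f => [|n IH] M l r W f lr Wlin Wl Wr ll rl fW fm.
  (* All vectors of length 0 are equal; u is a name for the only one. *)
  pose u : 'I_0 -> B := fun i => 0.
  split=> [v i c x y|v]; rewrite !(rdiff_arity0 _ _ _ _ u); last first.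
    by rewrite addrC -scaleN1r; apply: Wlin; [exact: Wr|exact: Wl].
  rewrite /replace_at (ord1 i) (_ : (ord_max == 0 :> 'I_1) = true) //.
  by rewrite ll // rl // scalerBr; abelian.
pose W' (h : B -> M) := linear h /\ forall c, W (h c).
have W0 : W 0 by have := Wlin (-1) _ _ (fW (fun=> 0)) (fW (fun=> 0)); rewrite scaleN1r addNr.
have WN m : W m -> W (- m) by move=> h; rewrite -scaleN1r -[_ *: _]addr0; exact: Wlin.
have WD x y : W x -> W y -> W (x + y) by move=> *; rewrite -[x]scale1r; exact: Wlin.
have /multilinear_curry[cm cl] := fm.
suff [Hm HW] : multilinear (rdiff (curry_l l) (curry_r r) (curry f)) /\
    forall v, W' (rdiff (curry_l l) (curry_r r) (curry f) v).
  split; last by move=> v; rewrite -[v]vrcons_eta rdiff_vrcons; exact: (HW _).2.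
  by apply/multilinear_curry; rewrite curry_rdiff; split=> // v; exact: (HW v).1.
have [lb rb _ _ _] := lr; apply: IH => //.
- exact: curry_pre.
- move=> c x y [xl xW] [yl yW]; split=> [d a b|d]; rewrite !fctE; last exact: Wlin.
  rewrite xl yl !scalerDr !scalerA (mulrC c d); abelian.
- move=> b h [hl hW]; split=> [c x y|c]; last exact: Wl.
  by rewrite /curry_l hl lb.
- move=> h b [hl hW]; split=> [c x y|c]; last by apply: WD => //; apply/WN/Wr.
  by rewrite /curry_r mulrDr -kscaleAr hl (rl _ (hW b)) scalerBr; abelian.
- by move=> h [hl hW] c x y; apply/funext => e; rewrite /curry_l ll.
- move=> h [hl hW] c x y; apply/funext => e; rewrite /curry_r !fctE.
  by rewrite mulrDl -kscaleAl !hl rb scalerBr; abelian.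
- by move=> v; split=> [c x y|c]; [exact: cl|exact: fW].
Qed.

Lemma hdiff_multilinear n (B : kAlgType k) (M : lmodType k) (s : bimod_on B B M)
    (f : ('I_n -> B) -> M) : multilinear f -> multilinear (hdiff s f).
Proof.
move=> fm; rewrite hdiffE.
have [] // := @rdiff_multilinear_in n B M _ _ (fun=> True) f (bimod_pre s).
- by move=> m _; exact: lact_linearl.
- by move=> m _; exact: ract_linearr.
Qed.

End Multilinear.

(** * The commutator with the variable on cochains of A *)

Section SkewCommutator.
Variables (k : comPzRingType) (A : kAlgType k) (sigma : alg_aut A).
Variable (delta : skew_derivation sigma).

(** Moving x past the arguments one by one through x a = sigma a x + delta a
    leaves delta in slot i, sigma before it and the identity after it. *)
Definition mix n (i : 'I_n) (v : 'I_n -> A) : 'I_n -> A :=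
  fun j => if (j < i)%N then sigma (v j) else if j == i then delta (v j) else v j.

(** X and Y stand for the left and the right multiplication by x; as
    parameters they can be transported to curried coefficients. *)
Definition skew_comm (M : lmodType k) (X Y : M -> M) n (f : ('I_n -> A) -> M) :
    ('I_n -> A) -> M :=
  fun v => X (f v) - Y (f (sigma \o v)) - \sum_(i < n) f (mix i v).

Lemma mix_widen n (i : 'I_n) v c :
  mix (widen_ord (leqnSn n) i) (vrcons v c) = vrcons (mix i v) c.
Proof.
apply: vrcons_ext; last first.
  by rewrite !vrcons_max /mix /= vrcons_max ltnNge ltnW //= -val_eqE /= gtn_eqF.
rewrite vinit_vrcons; apply/funext => j; rewrite /vinit /mix /= vrcons_widen.
by rewrite -val_eqE.
Qed.

Lemma mix_max n (v : 'I_n -> A) c :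
  mix ord_max (vrcons v c) = vrcons (sigma \o v) (delta c).
Proof.
apply: vrcons_ext; last by rewrite !vrcons_max /mix /= ltnn eqxx vrcons_max.
by rewrite vinit_vrcons; apply/funext => j; rewrite /vinit /mix /= ltn_ord vrcons_widen.
Qed.

(** The last summand of [skew_comm], the one with delta in the last slot, moves
    into the right multiplication. *)
Definition curry_Y (M : lmodType k) (Y : M -> M) (phi : A -> M) : A -> M :=
  fun c => Y (phi (sigma c)) + phi (delta c).

Lemma skew_comm_vrcons (M : lmodType k) (X Y : M -> M) n (f : ('I_n.+1 -> A) -> M) v c :
  skew_comm X Y f (vrcons v c) =
  skew_comm (fun phi : A -> M => X \o phi) (curry_Y Y) (curry f) v c.
Proof.
rewrite /skew_comm !(addrfctE, opprfctE) fct_sumE /curry_Y /curry big_ord_recr /= mix_max.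
rewrite vrcons_comp; under eq_bigr do rewrite mix_widen.
by abelian.
Qed.

Lemma curry_skew_comm (M : lmodType k) (X Y : M -> M) n (f : ('I_n.+1 -> A) -> M) :
  curry (skew_comm X Y f) =
  skew_comm (fun phi : A -> M => X \o phi) (curry_Y Y) (curry f).
Proof. by apply/funext => v; apply/funext => c; rewrite /curry skew_comm_vrcons. Qed.

(** The rules that X and Y inherit from x a = sigma a x + delta a.  The rule
    for [Y] holds after currying on linear functions only, whence W. *)
Record skew_pair (M : lmodType k) (l : A -> M -> M) (r : M -> A -> M) (W : M -> Prop)
    (X Y : M -> M) : Prop := SkewPair {
  skew_X : linear X;
  skew_Y : linear Y;
  skew_Xl : forall a m, X (l a m) = l (sigma a) (X m) + l (delta a) m;
  skew_Xr : forall m a, X (r m a) = r (X m) a;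
  skew_Yl : forall a m, Y (l a m) = l a (Y m);
  skew_Yr : forall m a, W m -> r (Y m) a = Y (r m (sigma a)) + r m (delta a)
}.

Lemma curry_skew_pair (M : lmodType k) (l : A -> M -> M) (r : M -> A -> M) W X Y :
  pre_bimod l r -> skew_pair l r W X Y ->
  skew_pair (curry_l l) (curry_r r) (fun phi => linear phi /\ forall c, W (phi c))
    (fun phi => X \o phi) (curry_Y Y).
Proof.
move=> [ll rl lM rM lrA] [Xl Yl Xl' Xr Yl' Yr]; split.
- by move=> c f g; apply/funext => a /=; rewrite !fctE Xl.
- move=> c f g; apply/funext => a /=; rewrite /curry_Y !fctE Yl scalerDr; abelian.
- by move=> a f; apply/funext => c; rewrite /curry_l /= Xl'.
- by move=> f a; apply/funext => c; rewrite /curry_r /= (linB Xl) Xr.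
- by move=> a f; apply/funext => c; rewrite /curry_l /curry_Y (linD (ll a)) Yl'.
move=> f a [fl fW]; apply/funext => c; rewrite /curry_r /curry_Y !fctE (linD (rl c)).
rewrite (Yr _ _ (fW _)) rmorphM sderM !(linD fl) !(linB Yl); abelian.
Qed.

(** The commutator with x is a chain map to the coefficients twisted by sigma
    on the left.  Currying reduces this to degree 0, where it says that
    m |-> x m - m x commutes with the differential. *)
Lemma skew_comm_rdiff n (M : lmodType k) (l : A -> M -> M) (r : M -> A -> M) W X Y
    (f : ('I_n -> A) -> M) :
  pre_bimod l r -> skew_pair l r W X Y -> multilinear f -> (forall v, W (f v)) ->
  skew_comm X Y (rdiff l r f) = rdiff (l \o sigma) r (skew_comm X Y f).
Proof.
elim: n M l r W X Y f => [|n IH] M l r W X Y f lr XY fm fW; last first.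
  apply/funext => v; rewrite -[v]vrcons_eta skew_comm_vrcons rdiff_vrcons.
  have /multilinear_curry[cm cl] := fm.
  rewrite curry_rdiff (IH _ _ _ _ _ _ _ (curry_pre lr) (curry_skew_pair lr XY)) //.
    by rewrite curry_skew_comm.
  by move=> w; split=> // c; exact: fW.
have [ll rl lM rM lrA] := lr; have [Xl Yl Xl' Xr Yl' Yr] := XY.
apply/funext => v; pose u : 'I_0 -> A := vinit v.
rewrite (rdiff_arity0 _ _ _ _ u) /skew_comm big_ord0 big_ord1 !(rdiff_arity0 _ _ _ _ u) /=.
have -> : mix ord0 v ord_max = delta (v ord_max) by rewrite /mix (ord1 ord_max).
rewrite (vec0 (sigma \o u) u) subr0 (linB Xl) (linB Yl) Xl' Xr Yl'.
by rewrite (linB (ll _)) (linB (rl _)) (Yr _ _ (fW _)); abelian.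
Qed.

Lemma skew_comm_multilinear (M : lmodType k) (X Y : M -> M) n (f : ('I_n -> A) -> M) :
  linear X -> linear Y -> multilinear f -> multilinear (skew_comm X Y f).
Proof.
move=> Xl Yl fm.
have -> : skew_comm X Y f = X \o f - (Y \o (fun v => f (sigma \o v))) -
    \sum_(i < n) (fun v => f (mix i v)).
  by apply/funext => v; rewrite !(addrfctE, opprfctE) fct_sumE.
apply: multilinear_add; last first.
  apply: multilinear_opp; apply: multilinear_sum => i.
  pose g (j : 'I_n) : A -> A := if (j < i)%N then (sigma : A -> A) else if j == i then (delta : A -> A) else id.
  rewrite (_ : (fun v => _) = fun v => id (f (fun j => g j (v j)))).
    apply: (multilinear_comp (phi := id) (g := g)) => // j; rewrite /g.
    by case: ifP => _; [exact: alg_hom_linear|case: ifP => // _; exact: linearP].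
  apply/funext => v; rewrite /=; congr f; apply/funext => j; rewrite /g /mix.
  by case: ifP => // _; case: ifP.
apply: multilinear_add; first exact: multilinear_post.
apply: multilinear_opp; apply: multilinear_post => //.
by apply: (multilinear_comp (phi := id) (g := fun=> sigma)) => // j; exact: alg_hom_linear.
Qed.

End SkewCommutator.

(** * Insertion of the variable into cochains of E *)

Lemma pre_restrict (k : comPzRingType) (B C : kAlgType k) (M : lmodType k)
    (l : B -> M -> M) (r : M -> B -> M) (f g : C -> B) :
  {morph f : a b / a * b} -> {morph g : a b / a * b} ->
  pre_bimod l r -> pre_bimod (l \o f) (fun m c => r m (g c)).
Proof.
move=> fM gM [ll rl lM rM lrA]; split=> //= *; first by rewrite fM.
by rewrite gM.
Qed.

Section Insertion.
Variables (k : comPzRingType) (A : kAlgType k) (sigma : alg_aut A).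
Variables (delta : skew_derivation sigma) (E : ore_extension delta).
Local Notation iota := (ore_incl E).
Local Notation x := (ore_var E).

Definition insert n (i : 'I_n.+1) (v : 'I_n -> A) : 'I_n.+1 -> E :=
  fun j => oapp (fun j' : 'I_n => iota (if (j' < i)%N then sigma (v j') else v j'))
                x (unlift i j).

(** The prism operator of the homotopy between the restrictions of f along the
    inclusion of A and along its composite with sigma: sigma is applied to the
    arguments that x has passed. *)
Definition var_slots (M : lmodType k) n (f : ('I_n.+1 -> E) -> M) : ('I_n -> A) -> M :=
  fun v => \sum_(i < n.+1) (-1) ^+ i *: f (insert i v).

Lemma insert_max n (v : 'I_n -> A) : insert ord_max v = vrcons (iota \o sigma \o v) x.
Proof.
apply: vrcons_ext; last by rewrite vrcons_max /insert unlift_none.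
rewrite vinit_vrcons; apply/funext => j; rewrite /vinit -lift_max_widen /insert /=.
by rewrite ?liftK lift_max_widen vrcons_widen /= ltn_ord.
Qed.

Lemma insert_widen n (i : 'I_n.+1) (v : 'I_n -> A) c :
  insert (widen_ord (leqnSn n.+1) i) (vrcons v c) = vrcons (insert i v) (iota c).
Proof.
apply: vrcons_ext.
  rewrite vinit_vrcons; apply/funext => j; rewrite /vinit.
  case: (unliftP i j) => [j'|] ->; last by rewrite /insert !unlift_none.
  have -> : widen_ord (leqnSn n.+1) (lift i j') =
      lift (widen_ord (leqnSn n.+1) i) (widen_ord (leqnSn n) j') by exact: val_inj.
  by rewrite /insert !liftK /= vrcons_widen.
rewrite vrcons_max.
have -> : ord_max = lift (widen_ord (leqnSn n.+1) i) (ord_max : 'I_n.+1).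
  by apply: val_inj; rewrite /= /bump -ltnS ltn_ord.
by rewrite /insert liftK /= vrcons_max ltnNge -ltnS ltn_ord.
Qed.

Lemma var_slots_vrcons (M : lmodType k) n (f : ('I_n.+2 -> E) -> M) v c :
  var_slots f (vrcons v c) = var_slots (curry f : _ -> E -> M) v (iota c) +
    (-1) ^+ n.+1 *: f (vrcons (vrcons (iota \o sigma \o v) (iota (sigma c))) x).
Proof.
rewrite {1}/var_slots big_ord_recr /= insert_max; congr (_ + _ *: f (vrcons _ _)).
  rewrite /var_slots fct_sumE; apply: eq_bigr => i _.
  by rewrite scalrfctE insert_widen.
by rewrite -vrcons_comp.
Qed.

Lemma var_slots_multilinear (M : lmodType k) n (f : ('I_n.+1 -> E) -> M) :
  multilinear f -> multilinear (var_slots f).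
Proof.
move=> fm.
have -> : var_slots f = \sum_(i < n.+1) (-1) ^+ i *: (fun v => f (insert i v)).
  by apply/funext => v; rewrite fct_sumE.
apply: multilinear_sum => i; apply: multilinear_scale => v j c a b.
pose g (b : A) := iota (if (j < i)%N then sigma b else b).
have E' b' : insert i (replace_at v j b') = replace_at (insert i v) (lift i j) (g b').
  apply/funext => j'; rewrite /insert /replace_at.
  case: (unliftP i j') => [j''|] -> /=; rewrite ?liftK ?unlift_none /=.
    rewrite (inj_eq lift_inj); case: eqP => // ->.
    by [].
  by rewrite (negPf (neq_lift _ _)).
rewrite !E'.
have -> : g (c *: a + b) = c *: g a + g b.
  by rewrite /g; case: ifP => _; rewrite ?alg_hom_linear.
exact: fm.
Qed.

Lemma rdiff_parts (B : kAlgType k) (M : lmodType k) (l : B -> M -> M) (r : M -> B -> M) n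
    (f : ('I_n -> B) -> M) v :
  rdiff l r f v = (l (v ord0) (f (vtail v)) + \sum_(j < n) (-1) ^+ j.+1 *: f (merge_at j v))
    + (-1) ^+ n.+1 *: r (f (vinit v)) (v ord_max).
Proof. by []. Qed.

Lemma insert1 (v : 'I_0 -> A) i j : insert i v j = x.
Proof. by rewrite (ord1 i) (ord1 j) /insert unlift_none. Qed.

(** In degree 0 there is no slot to fill, so the identity of
    [var_slots_rdiff] has no second term. *)
Lemma var_slots_rdiff0 (M : lmodType k) (l : E -> M -> M) (r : M -> E -> M)
    (f : ('I_0 -> E) -> M) :
  var_slots (rdiff l r f) = skew_comm delta (l x) (r^~ x) (fun v => f (iota \o v)).
Proof.
apply/funext => v; rewrite /var_slots big_ord1 expr0 scale1r /skew_comm big_ord0 subr0.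
rewrite (rdiff_arity0 _ _ _ _ (iota \o v)) (vec0 (sigma \o v) v) insert1.
by [].
Qed.

(** Restriction to A and [var_slots] form a chain map from the cochains of E
    to the cone of the commutator with x.  The last
    argument of f ranges over E and that of its restriction over A, so the
    induction compares the coefficients Hom(E, M) with Hom(A, M): the two right
    multiplications by x on them differ by the terms f(.., sigma c x),
    f(.., x) c and f(.., sigma c) x, and the same terms come from the insertion
    of x into the last slot. *)
Lemma var_slots_rdiff n (M : lmodType k) (l : E -> M -> M) (r : M -> E -> M)
    (W : M -> Prop) (f : ('I_n.+1 -> E) -> M) :
  pre_bimod l r -> (forall m, W m -> linear (r m)) -> multilinear f ->
  (forall v, W (f v)) ->
  var_slots (rdiff l r f) = skew_comm delta (l x) (r^~ x) (fun v => f (iota \o v)) -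
    rdiff (l \o iota \o sigma) (fun m a => r m (iota a)) (var_slots f).
Proof.
elim: n M l r W f => [|n IH] M l r W f lr rW fm fW; have [ll rl lM rM lrA] := lr;
  have /multilinear_curry[cm cl] := fm.
  apply/funext => v; pose u : 'I_0 -> A := vinit v; rewrite -[v]vrcons_eta.
  set c := v ord_max; pose w : 'I_0 -> E := iota \o u; pose phi := curry f w.
  have fE z : f z = phi (z ord_max).
    by rewrite -[z in LHS]vrcons_eta /phi /curry (vec0 (vinit z) w).
  have fl : linear phi by exact: cl.
  rewrite var_slots_vrcons curry_rdiff var_slots_rdiff0 !(addrfctE, opprfctE).
  rewrite /skew_comm big_ord0 subr0 big_ord1 !(addrfctE, opprfctE).
  rewrite (rdiff_arity0 _ _ _ _ u) rdiff_vrcons (rdiff_arity0 _ _ _ _ w).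
  rewrite !(addrfctE, opprfctE) (vec0 (iota \o (sigma \o vinit v)) w).
  rewrite (vec0 (iota \o vinit v) w) -/phi /curry_l /curry_r /var_slots big_ord1.
  rewrite !fE /= !vrcons_max /mix /= vrcons_max insert1.
  rewrite expr1 scaleN1r expr0 scale1r ore_comm (linD fl) /=; abelian.
apply/funext => v; rewrite -[v]vrcons_eta; set c := v ord_max; set a := vinit v.
rewrite var_slots_vrcons curry_rdiff.
have cW w : linear (curry f w) /\ forall e, W (curry f w e).
  by split=> [|e]; [exact: cl|exact: fW].
pose W' (phi : E -> M) := linear phi /\ forall e, W (phi e).
rewrite (IH _ _ _ W' _ (curry_pre lr) _ cm cW); last first.
  move=> phi [hl hW] d y z; apply/funext => e.
  rewrite /curry_r !(addrfctE, scalrfctE) mulrDl -kscaleAl !hl rl scalerBr; abelian.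
rewrite !(addrfctE, opprfctE) !rdiff_vrcons skew_comm_vrcons.
(* K is, up to sign, the part of [var_slots f] with x in the last slot. *)
pose K (z : 'I_n -> A) (e : A) : M :=
  f (vrcons (vrcons (iota \o sigma \o z) (iota (sigma e))) x).
have -> : curry (var_slots f) =
    (-1) ^+ n.+1 *: K + (fun z e => var_slots (curry f : _ -> E -> M) z (iota e)).
  apply/funext => z; apply/funext => e; rewrite /curry var_slots_vrcons addrC.
  by [].
have lr' : pre_bimod (l \o iota \o sigma) (fun m a => r m (iota a)).
  by apply: pre_restrict lr => y z /=; rewrite !rmorphM.
rewrite (rdiff_linear (curry_pre lr')) !(addrfctE, scalrfctE).
(* Restricting functions from E to A intertwines the two curried actions. *)
have <- : rdiff (curry_l l \o iota \o sigma) (fun m a => curry_r r m (iota a))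
      (var_slots (curry f : _ -> E -> M)) a (iota c) =
    rdiff (curry_l (l \o iota \o sigma)) (curry_r (fun m a => r m (iota a)))
      (fun z e => var_slots (curry f : _ -> E -> M) z (iota e)) a c.
  pose res (phi : E -> M) : A -> M := phi \o iota.
  have := @rdiff_natural k A A (E -> M) (A -> M) id res _ _
    (curry_l l \o iota \o sigma) (fun m a => curry_r r m (iota a))
    (curry_l (l \o iota \o sigma)) (curry_r (fun m a => r m (iota a))) _ _ n
    (var_slots (curry f : _ -> E -> M)).
  move=> h; rewrite (h _ _ _ _) //.
    by move=> phi b; apply/funext => e; rewrite /res /curry_r /= rmorphM.
pose phi := curry f (iota \o sigma \o a).
have fl : linear phi by exact: cl.
(* The two differentials differ in their last term only: currying twice over
   E and then setting the last variable to x is not compatible with the right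
   action. *)
have -> : rdiff (curry_l (curry_l l)) (curry_r (curry_r r)) (curry (curry f))
      (iota \o sigma \o a) (iota (sigma c)) x =
    rdiff (curry_l (l \o iota \o sigma)) (curry_r (fun m a => r m (iota a))) K a c
    + (-1) ^+ n.+1 *: (r (phi x) (iota c) - phi (iota (sigma c) * x)
                       + r (phi (iota (sigma c))) x).
  have compM : {morph iota \o sigma : y z / y * z} by move=> y z /=; rewrite !rmorphM.
  rewrite !rdiff_parts !(addrfctE, scalrfctE) !fct_sumE -!addrA; congr (_ + (_ + _)).
    by apply: eq_bigr => j _; rewrite (merge_at_comp compM).
  rewrite -scalerDr; congr (_ *: _).
  have phiE e : f (vrcons (vrcons (vinit (iota \o sigma \o a)) (iota (sigma (a ord_max)))) e)
      = phi e by rewrite /phi /curry -[in RHS](vrcons_eta (iota \o sigma \o a)).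
  rewrite /curry_r !(addrfctE, opprfctE) /K /= /curry !rmorphM !phiE; abelian.
have sgn : (-1) ^+ n.+2 * (-1) ^+ n.+1 = -1 :> k.
  by rewrite exprS -mulrA -expr2 sqrr_sign mulr1.
rewrite scalerDr scalerA sgn scaleN1r [(-1) ^+ n.+2]exprS mulN1r scaleNr /skew_comm.
rewrite !(addrfctE, opprfctE) !fct_sumE /curry_l /curry_r /curry_Y /=.
have curE z e : curry (fun v0 : 'I_n.+2 -> A => f (iota \o v0)) z e =
    curry f (iota \o z) (iota e) by rewrite /curry vrcons_comp.
under [X in _ = _ - X - _]eq_bigr do rewrite curE.
rewrite !curE -[curry f (iota \o (sigma \o a))]/phi ore_comm (linD fl); abelian.
Qed.

End Insertion.

(** * Coinduced bimodules *)

Section Submodule.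
Variables (k : comPzRingType) (V : lmodType k) (W : V -> bool).
Variable Wsub : submod_closed W.

Record sub_mod (Wp : submod_closed W) := SubMod {
  sub_val : V;
  sub_valP : W sub_val
}.
HB.instance Definition _ := [isSub for @sub_val Wsub].
HB.instance Definition _ := [Choice of sub_mod Wsub by <:].
HB.instance Definition _ :=
  GRing.SubChoice_isSubLmodule.Build k V W (sub_mod Wsub)
    (GRing.submod_closed_semi Wsub).

Lemma sub_val_linear : linear (@sub_val Wsub).
Proof. by move=> c x y; exact: (linearP (\val : sub_mod Wsub -> V)). Qed.

Lemma sub_val_inj : injective (@sub_val Wsub).
Proof. exact: val_inj. Qed.

Variables (B C : kAlgType k) (l : B -> V -> V) (r : V -> C -> V).
Hypotheses (ll : forall b, linear (l b)) (rl : forall c, linear (r^~ c))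
  (lM : forall b b' v, l (b * b') v = l b (l b' v))
  (rM : forall c c' v, r v (c * c') = r (r v c) c')
  (lr : forall b v c, r (l b v) c = l b (r v c)).
Hypotheses (Wl : forall b v, W v -> W (l b v)) (Wr : forall v c, W v -> W (r v c))
  (l_lin : forall v, W v -> linear (l^~ v)) (r_lin : forall v, W v -> linear (r v))
  (l1 : forall v, W v -> l 1 v = v) (r1 : forall v, W v -> r v 1 = v).

Definition sub_bimod : bimod_on B C (sub_mod Wsub).
Proof.
refine (@BimodOn k B C (sub_mod Wsub)
  (fun b v => SubMod Wsub (Wl b (sub_valP v)))
  (fun v c => SubMod Wsub (Wr c (sub_valP v))) _ _ _ _ _ _ _ _ _).
- by move=> b c x y; apply: sub_val_inj; rewrite /= ll.
- by move=> v c x y; apply: sub_val_inj; rewrite /= (l_lin (sub_valP v)).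
- by move=> v; apply: sub_val_inj; exact: l1 (sub_valP v).
- by move=> b b' v; apply: sub_val_inj; exact: lM.
- by move=> b c x y; apply: sub_val_inj; rewrite /= rl.
- by move=> v c x y; apply: sub_val_inj; rewrite /= (r_lin (sub_valP v)).
- by move=> v; apply: sub_val_inj; exact: r1 (sub_valP v).
- by move=> c c' v; apply: sub_val_inj; exact: rM.
- by move=> b v c; apply: sub_val_inj; exact: lr.
Defined.

End Submodule.

(** A predicate on plain functions, so that maps between bimodules compose with
    cochains and need no bundled structure for each composite. *)
Definition bimod_map (k : comPzRingType) (B C : kAlgType k) (M N : lmodType k)
    (s : bimod_on B C M) (t : bimod_on B C N) (phi : M -> N) : Prop :=
  [/\ linear phi, forall b m, phi (lact s b m) = lact t b (phi m)
    & forall m c, phi (ract s m c) = ract t (phi m) c].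

Section Coinduction.
Variables (k : comPzRingType) (B : kAlgType k) (M : lmodType k).

Definition linear_pred (U : lmodType k) (phi : U -> M) : bool := `[< linear phi >].

Lemma linear_submod (U : lmodType k) : submod_closed (@linear_pred U).
Proof.
split; first by apply/asboolP => c x y; rewrite scaler0 addr0.
move=> c f g /asboolP fl /asboolP gl; apply/asboolP => d x y.
rewrite !(addrfctE, scalrfctE) fl gl !scalerDr !scalerA (mulrC d); abelian.
Qed.

Definition Lin (U : lmodType k) := sub_mod (@linear_submod U).

Lemma Lin_linear (U : lmodType k) (q : Lin U) : linear (sub_val q).
Proof. by apply/asboolP; exact: (sub_valP q). Qed.

Definition mkLin (U : lmodType k) (phi : U -> M) (h : linear phi) : Lin U :=
  SubMod (@linear_submod U) (asboolT h).

Definition pointed_pred (phi : B -> M) : bool := `[< linear phi /\ phi 1 = 0 >].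

Lemma pointed_submod : submod_closed pointed_pred.
Proof.
split; first by apply/asboolP; split=> // c x y; rewrite scaler0 addr0.
move=> c f g /asboolP[fl f1] /asboolP[gl g1]; apply/asboolP; split=> [d x y|].
  rewrite !(addrfctE, scalrfctE) fl gl !scalerDr !scalerA (mulrC d); abelian.
by rewrite !(addrfctE, scalrfctE) f1 g1 scaler0 addr0.
Qed.

(** The cokernel M' of the embedding of M into the linear maps from B to M: the
    class of q modulo M contains exactly one map that kills 1, which is
    c |-> q c - q 1 c. *)
Definition Lin0 := sub_mod pointed_submod.

Lemma Lin0_linear (q : Lin0) : linear (sub_val q).
Proof. by have /asboolP[] := sub_valP q. Qed.

Lemma Lin0_1 (q : Lin0) : sub_val q 1 = 0.
Proof. by have /asboolP[] := sub_valP q. Qed.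

Variable s : bimod_on B B M.
Local Notation l := (lact s).
Local Notation r := (ract s).

(** The right action by translation of the argument.  The left action acts on
    values, so that only the left module structure of the algebra matters when
    cohomology is computed over a subalgebra. *)
Definition coind_r (phi : B -> M) (b : B) : B -> M := fun c => phi (b * c).

Definition coind_on : bimod_on B B (Lin B).
Proof.
refine (@sub_bimod k (B -> M) (@linear_pred B) (@linear_submod B) B B (curry_l l) coind_r
  _ _ _ _ _ _ _ _ _ _ _).
- by move=> b c f g; apply/funext => e; rewrite /curry_l !(addrfctE, scalrfctE) lact_linear.
- by [].
- by move=> b b' f; apply/funext => e; rewrite /curry_l lactM.
- by move=> c c' f; apply/funext => e; rewrite /coind_r mulrA.
- by [].
- by move=> b f /asboolP fl; apply/asboolP => c x y; rewrite /curry_l fl lact_linear.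
- by move=> f b /asboolP fl; apply/asboolP => c x y; rewrite /coind_r mulrDr -kscaleAr fl.
- by move=> f _ c x y; apply/funext => e; rewrite /curry_l lact_linearl.
- move=> f /asboolP fl c x y; apply/funext => e.
  by rewrite /coind_r mulrDl -kscaleAl fl.
- by move=> f _; apply/funext => e; rewrite /curry_l lact1.
- by move=> f _; apply/funext => e; rewrite /coind_r mul1r.
Defined.

(** Hochschild's action [curry_r], which is unital on the maps that kill 1. *)
Definition coind0_on : bimod_on B B Lin0.
Proof.
refine (@sub_bimod k (B -> M) pointed_pred pointed_submod B B (curry_l l) (curry_r r)
  (pre_ll (curry_pre (bimod_pre s))) (pre_rl (curry_pre (bimod_pre s)))
  (pre_lM (curry_pre (bimod_pre s))) (pre_rM (curry_pre (bimod_pre s)))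
  (pre_lr (curry_pre (bimod_pre s))) _ _ _ _ _ _).
- move=> b f /asboolP[fl f1]; apply/asboolP; split=> [c x y|]; first by rewrite /curry_l fl lact_linear.
  by rewrite /curry_l f1 (lin0 (lact_linear s b)).
- move=> f b /asboolP[fl f1]; apply/asboolP; split=> [c x y|]; last first.
    by rewrite /curry_r mulr1 ract1 subrr.
  by rewrite /curry_r mulrDr -kscaleAr fl ract_linearr scalerBr; abelian.
- by move=> f _ c x y; apply/funext => e; rewrite /curry_l lact_linearl.
- move=> f /asboolP[fl f1] c x y; apply/funext => e.
  by rewrite !(addrfctE, scalrfctE) /curry_r mulrDl -kscaleAl !fl ract_linear scalerBr; abelian.
- by move=> f _; apply/funext => e; rewrite /curry_l lact1.
- move=> f /asboolP[fl f1]; apply/funext => e.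
  by rewrite /curry_r mul1r f1 (lin0 (ract_linear s e)) subr0.
Defined.

Lemma coind_lactE b q c : sub_val (lact coind_on b q) c = l b (sub_val q c).
Proof. by []. Qed.
Lemma coind_ractE b q c : sub_val (ract coind_on q b) c = sub_val q (b * c).
Proof. by []. Qed.
Lemma coind0_lactE b q c : sub_val (lact coind0_on b q) c = l b (sub_val q c).
Proof. by []. Qed.
Lemma coind0_ractE b q c :
  sub_val (ract coind0_on q b) c = sub_val q (b * c) - r (sub_val q b) c.
Proof. by []. Qed.

(** [coind_incl] and [coind_proj] are the maps of the short exact sequence
    M -> Hom(B, M) -> M'; [coind_ev] and [coind_sec] split it over k, which is
    why cochains lift along it. *)
Definition coind_incl (m : M) : Lin B := mkLin (ract_linearr s m).
Definition coind_ev (q : Lin B) : M := sub_val q 1.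

Lemma coind_proj_subproof (q : Lin B) :
  pointed_pred (fun c => sub_val q c - r (sub_val q 1) c).
Proof.
apply/asboolP; split=> [c x y|]; last by rewrite ract1 subrr.
by rewrite Lin_linear ract_linearr scalerBr; abelian.
Qed.
Definition coind_proj (q : Lin B) : Lin0 :=
  SubMod pointed_submod (coind_proj_subproof q).

Definition coind_sec (q : Lin0) : Lin B := mkLin (Lin0_linear q).

Lemma coind_incl_map : bimod_map s coind_on coind_incl.
Proof.
split=> [c x y|b m|m b]; apply: sub_val_inj; apply/funext => e.
- by rewrite /= ract_linear.
- by rewrite coind_lactE /= lractA.
- by rewrite coind_ractE /= ractM.
Qed.

Lemma coind_proj_map : bimod_map coind_on coind0_on coind_proj.
Proof.
have [ll rl lM rM lrA] := bimod_pre s.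
split=> [c x y|b m|m b]; apply: sub_val_inj; apply/funext => e.
- rewrite /= !(addrfctE, scalrfctE) ract_linear.
  by rewrite scalerBr; abelian.
- by rewrite coind0_lactE /= /curry_l (linB (ll b)) lractA.
- by rewrite coind0_ractE /= /coind_r mulr1 (linB (rl e)) ractM; abelian.
Qed.

Lemma coind_ev_linear : linear coind_ev.
Proof. by move=> c x y; rewrite /coind_ev sub_val_linear. Qed.

Lemma coind_sec_linear : linear coind_sec.
Proof. by move=> c x y; apply: sub_val_inj; rewrite /=. Qed.

Lemma coind_inclK : cancel coind_incl coind_ev.
Proof. by move=> m; rewrite /coind_ev /= ract1. Qed.

Lemma coind_secK : cancel coind_sec coind_proj.
Proof.
move=> q; apply: sub_val_inj; apply/funext => c.
by rewrite /= Lin0_1 (lin0 (ract_linear s c)) subr0.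
Qed.

Lemma coind_proj_incl m : coind_proj (coind_incl m) = 0.
Proof. by apply: sub_val_inj; apply/funext => c; rewrite /= ract1 subrr. Qed.

Lemma coind_proj_eq0 q : coind_proj q = 0 -> coind_incl (coind_ev q) = q.
Proof.
move=> /(congr1 (fun h : Lin0 => sub_val h)) h; apply: sub_val_inj; apply/funext => c.
by apply/esym/eqP; rewrite -subr_eq0; apply/eqP; exact: (congr1 (fun f => f c) h).
Qed.

End Coinduction.

(** * Cocycles and coboundaries *)

Section BimodMaps.
Variables (k : comPzRingType) (B : kAlgType k) (M N : lmodType k).
Variables (s : bimod_on B B M) (t : bimod_on B B N) (phi : M -> N).
Hypothesis phim : bimod_map s t phi.

Lemma hdiff_map n (f : ('I_n -> B) -> M) : hdiff t (phi \o f) = phi \o hdiff s f.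
Proof.
have [pl pL pR] := phim; rewrite !hdiffE.
exact: (@rdiff_natural k B B M N id phi (fun a b => erefl) pl _ _ _ _ pL pR n f).
Qed.

Lemma coboundary_map n (f : ('I_n -> B) -> M) :
  is_coboundary s f -> is_coboundary t (phi \o f).
Proof.
have [pl _ _] := phim.
case: n f => [|n] f /= => [->|[g [gm ->]]].
  by apply/funext => v; exact: lin0 pl.
by exists (phi \o g); split; [exact: multilinear_post|rewrite hdiff_map].
Qed.

Lemma cocycle_map_post n (f : ('I_n -> B) -> M) :
  is_cocycle s f -> is_cocycle t (phi \o f).
Proof.
have [pl _ _] := phim; move=> [fm fd]; split; first exact: multilinear_post.
by rewrite hdiff_map fd; apply/funext => v; exact: lin0 pl.
Qed.

End BimodMaps.

Section PointwiseMaps.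
Variables (k : comPzRingType) (T : Type) (M N : lmodType k) (phi : M -> N).
Hypothesis phil : linear phi.
Implicit Types f g : T -> M.
Lemma postD f g : phi \o (f + g) = (phi \o f) + (phi \o g).
Proof. by apply/funext => v; exact: linD. Qed.
Lemma postB f g : phi \o (f - g) = (phi \o f) - (phi \o g).
Proof. by apply/funext => v; exact: linB. Qed.
Lemma post0 : phi \o (0 : T -> M) = 0.
Proof. by apply/funext => v; exact: lin0. Qed.
End PointwiseMaps.

Section HdiffFacts.
Variables (k : comPzRingType) (B : kAlgType k) (M : lmodType k) (s : bimod_on B B M).

Lemma hdiffD n (f g : ('I_n -> B) -> M) : hdiff s (f + g) = hdiff s f + hdiff s g.
Proof. exact: linD (@hdiff_linear k B M s n) f g. Qed.
Lemma hdiffB n (f g : ('I_n -> B) -> M) : hdiff s (f - g) = hdiff s f - hdiff s g.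
Proof. exact: linB (@hdiff_linear k B M s n) f g. Qed.
Lemma hdiffN n (f : ('I_n -> B) -> M) : hdiff s (- f) = - hdiff s f.
Proof. exact: linN (@hdiff_linear k B M s n) f. Qed.
Lemma hdiffZ n c (f : ('I_n -> B) -> M) : hdiff s (c *: f) = c *: hdiff s f.
Proof. exact: linZ (@hdiff_linear k B M s n) c f. Qed.

Lemma arity0_cocycle_central (f : ('I_0 -> B) -> M) u : hdiff s f = 0 ->
  forall b, lact s b (f u) = ract s (f u) b.
Proof.
move=> fd b; have /eqP := congr1 (fun h => h (fun=> b)) fd.
by rewrite hdiffE (rdiff_arity0 _ _ _ _ u) subr_eq0 => /eqP.
Qed.

Lemma hdiff_hdiff n (f : ('I_n -> B) -> M) : hdiff s (hdiff s f) = 0.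
Proof. exact: rdiff_rdiff (bimod_pre s). Qed.

Lemma coboundary_cocycle n (f : ('I_n -> B) -> M) : is_coboundary s f -> is_cocycle s f.
Proof.
case: n f => [|n] f /= => [->|[g [gm ->]]].
  by split; [exact: multilinear0|exact: hdiff0].
by split; [exact: hdiff_multilinear|exact: hdiff_hdiff].
Qed.

Lemma coboundaryD n (f g : ('I_n -> B) -> M) :
  is_coboundary s f -> is_coboundary s g -> is_coboundary s (f + g).
Proof. by move=> hf hg; rewrite -[f]scale1r; exact: is_coboundaryP. Qed.

Lemma coboundary0 n : is_coboundary s (0 : ('I_n -> B) -> M).
Proof.
case: n => //= n; exists 0; split; first exact: multilinear0.
by rewrite hdiff0.
Qed.

Lemma coboundaryN n (f : ('I_n -> B) -> M) : is_coboundary s f -> is_coboundary s (- f).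
Proof.
move=> hf; rewrite -scaleN1r -[_ *: _]addr0; apply: is_coboundaryP => //.
exact: coboundary0.
Qed.

Lemma coboundaryB n (f g : ('I_n -> B) -> M) :
  is_coboundary s f -> is_coboundary s g -> is_coboundary s (f - g).
Proof. by move=> hf /coboundaryN; exact: coboundaryD. Qed.

End HdiffFacts.

Section CoinducedPrimitive.
Variables (k : comPzRingType) (B : kAlgType k) (M : lmodType k) (s : bimod_on B B M).

(** A cocycle of positive degree becomes a coboundary in the coinduced module:
    currying its last argument gives a primitive, up to sign, because the
    actions [coind_r] and [curry_r] on curried cochains differ by the embedding
    of M. *)
Lemma coind_primitive n (z : ('I_n.+1 -> B) -> M) : is_cocycle s z ->
  exists u : ('I_n -> B) -> Lin M B,
    multilinear u /\ hdiff (coind_on s) u = coind_incl s \o z.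
Proof.
move=> [zm zd]; have /multilinear_curry[cm cl] := zm.
pose u v := mkLin (cl v); have um : multilinear u.
  move=> v i c x y; apply: sub_val_inj; rewrite sub_val_linear /=; exact: cm.
exists ((-1) ^+ n.+1 *: u); split; first exact: multilinear_scale.
rewrite hdiffZ; apply/funext => v; rewrite scalrfctE; apply: sub_val_inj; apply/funext => c.
rewrite (linZ (@sub_val_linear _ _ _ _)) scalrfctE.
have h := congr1 (fun f => f (vrcons v c)) zd; rewrite hdiffE rdiff_vrcons in h.
suff -> : sub_val (hdiff (coind_on s) u v) c = (-1) ^+ n.+1 *: ract s (z v) c.
  by rewrite scalerA -expr2 sqrr_sign scale1r.
(* The value of dz, which is 0, has the same terms except the last one. *)
rewrite -[LHS]subr0 -[X in _ - X]h /rdiff /hdiff.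
rewrite !(linD (@sub_val_linear _ _ _ _)) (lin_sum (@sub_val_linear _ _ _ _)).
rewrite !(linZ (@sub_val_linear _ _ _ _)) /= /curry_r /coind_r.
rewrite !(addrfctE, opprfctE, scalrfctE) !fct_sumE scalerBr.
have -> : z v = curry z (vinit v) (v ord_max) by rewrite /curry vrcons_eta.
rewrite /= /vtail /vinit; abelian.
Qed.

End CoinducedPrimitive.

Section CoindFun.
Variables (k : comPzRingType) (B : kAlgType k) (M : lmodType k) (s : bimod_on B B M) (T : Type).

Lemma post_proj_incl (f : T -> M) : coind_proj s \o (coind_incl s \o f) = 0.
Proof. by apply/funext => v; exact: coind_proj_incl. Qed.

Lemma post_proj_sec (f : T -> Lin0 B M) : coind_proj s \o (@coind_sec k B M \o f) = f.
Proof. by apply/funext => v; exact: coind_secK. Qed.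

Lemma post_proj_eq0 (f : T -> Lin M B) : coind_proj s \o f = 0 ->
  coind_incl s \o (@coind_ev k B M \o f) = f.
Proof.
move=> h; apply/funext => v; apply: coind_proj_eq0.
exact: (congr1 (fun z => z v) h).
Qed.

Lemma post_incl_inj (f g : T -> M) : coind_incl s \o f = coind_incl s \o g -> f = g.
Proof.
move=> h; apply/funext => v; apply: (can_inj (coind_inclK s)).
exact: (congr1 (fun z => z v) h).
Qed.

End CoindFun.

(** The connecting map, on a cochain of the coinduced module that is a
    coboundary modulo M: its differential is then the differential of a cochain
    in M.  The three structures tM, tQ and tH may be restrictions or twists of
    the original ones. *)
Lemma coind_descend (k : comPzRingType) (B C : kAlgType k) (M : lmodType k) (s : bimod_on B B M)
    (tM : bimod_on C C M) (tQ : bimod_on C C (Lin M B)) (tH : bimod_on C C (Lin0 B M))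
    n (T : ('I_n -> C) -> Lin M B) :
  bimod_map tM tQ (coind_incl s) -> bimod_map tQ tH (coind_proj s) ->
  multilinear T -> is_coboundary tH (coind_proj s \o T) ->
  exists T0, multilinear T0 /\ hdiff tQ T = coind_incl s \o hdiff tM T0.
Proof.
move=> im pm; have [pl _ _] := pm; have el := @coind_ev_linear k B M.
move=> Tm; case: n T Tm => [|n] T Tm /= => [pT|[g [gm gd]]].
  exists (@coind_ev k B M \o T); split; first exact: multilinear_post.
  by rewrite -(hdiff_map im) post_proj_eq0.
pose T1 := T - hdiff tQ (@coind_sec k B M \o g).
have sm : multilinear (@coind_sec k B M \o g).
  by apply: multilinear_post => //; exact: coind_sec_linear.
exists (@coind_ev k B M \o T1); split.
  apply: multilinear_post => //; apply: multilinear_add => //.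
  by apply/multilinear_opp/hdiff_multilinear.
rewrite -(hdiff_map im) post_proj_eq0; first by rewrite hdiffB hdiff_hdiff subr0.
by rewrite (postB pl) -(hdiff_map pm) post_proj_sec gd subrr.
Qed.

(** * The cone of the commutator with the variable *)

Section OreCochains.
Variables (k : comPzRingType) (A : kAlgType k) (sigma : alg_aut A).
Variables (delta : skew_derivation sigma) (E : ore_extension delta).
Local Notation iota := (ore_incl E).
Local Notation x := (ore_var E).

Definition res_on (M : lmodType k) (s : bimod_on E E M) : bimod_on A A M :=
  restrict_bimod iota iota s.

Definition tw_on (M : lmodType k) (s : bimod_on E E M) : bimod_on A A M :=
  restrict_bimod (alg_comp iota sigma) iota s.

Definition restr (M : lmodType k) n (F : ('I_n -> E) -> M) : ('I_n -> A) -> M :=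
  fun v => F (iota \o v).

(** H(E, M) is the cohomology of the cone of this chain map. *)
Definition var_comm (M : lmodType k) (s : bimod_on E E M) n (f : ('I_n -> A) -> M) :
    ('I_n -> A) -> M :=
  skew_comm delta (lact s x) ((ract s)^~ x) f.

Section OneModule.
Variables (M : lmodType k) (s : bimod_on E E M).

Lemma restr_multilinear n (F : ('I_n -> E) -> M) : multilinear F -> multilinear (restr F).
Proof.
move=> Fm; apply: (multilinear_comp (phi := id) (g := fun=> iota)) => // i.
exact: alg_hom_linear.
Qed.

Lemma restr_hdiff n (F : ('I_n -> E) -> M) :
  hdiff (res_on s) (restr F) = restr (hdiff s F).
Proof.
exact: (@rdiff_natural k E A M M iota id (rmorphM iota) _ (lact s) (ract s)).
Qed.

Lemma var_comm_multilinear n (f : ('I_n -> A) -> M) :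
  multilinear f -> multilinear (var_comm s f).
Proof. by apply: skew_comm_multilinear; [exact: lact_linear|exact: ract_linear]. Qed.

Lemma var_comm_linear n : linear (@var_comm M s n).
Proof.
move=> c f g; apply/funext => v; rewrite /var_comm /skew_comm !(addrfctE, scalrfctE).
rewrite (lact_linear s) (ract_linear s) big_split /= -scaler_sumr !scalerBr; abelian.
Qed.

Lemma var_slots_linear n : linear (@var_slots k A sigma delta E M n).
Proof.
move=> c f g; apply/funext => v; rewrite !(addrfctE, scalrfctE) /var_slots.
rewrite scaler_sumr -big_split /=; apply: eq_bigr => i _.
by rewrite scalerDr !scalerA mulrC.
Qed.

Lemma var_comm_hdiff n (f : ('I_n -> A) -> M) : multilinear f ->
  var_comm s (hdiff (res_on s) f) = hdiff (tw_on s) (var_comm s f).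
Proof.
move=> fm; pose W (m : M) := True.
have lr := pre_restrict (rmorphM iota) (rmorphM iota) (bimod_pre s).
have sp : skew_pair delta (lact s \o iota) (fun m a => ract s m (iota a)) W
    (lact s x) ((ract s)^~ x).
  split=> [||a m|m a|a m|m a _] /=.
  - exact: lact_linear.
  - exact: ract_linear.
  - by rewrite -!lactM ore_comm (linD (lact_linearl s m)).
  - by rewrite lractA.
  - by rewrite lractA.
  - by rewrite -!ractM ore_comm (linD (ract_linearr s m)).
rewrite /var_comm !hdiffE (skew_comm_rdiff lr sp) //.
Qed.

Lemma var_slots_hdiff0 (F : ('I_0 -> E) -> M) :
  var_slots (hdiff s F) = var_comm s (restr F).
Proof. by rewrite hdiffE var_slots_rdiff0. Qed.

Lemma var_slots_hdiff n (F : ('I_n.+1 -> E) -> M) : multilinear F ->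
  var_slots (hdiff s F) = var_comm s (restr F) - hdiff (tw_on s) (var_slots F).
Proof.
move=> Fm; rewrite !hdiffE (@var_slots_rdiff _ _ _ _ _ _ _ _ _ (fun=> True)) //.
  exact: bimod_pre.
by move=> m _; exact: ract_linearr.
Qed.

Lemma var_comm_coboundary n (y : ('I_n -> A) -> M) :
  is_coboundary (res_on s) y -> is_coboundary (tw_on s) (var_comm s y).
Proof.
case: n y => [|n] y /= => [->|[g [gm ->]]].
  exact: (lin0 (@var_comm_linear _)).
exists (var_comm s g); split; first exact: var_comm_multilinear.
exact: var_comm_hdiff.
Qed.

Lemma var_slots_hdiff_coboundary n (G : ('I_n -> E) -> M) : multilinear G ->
  is_coboundary (tw_on s) (var_slots (hdiff s G) - var_comm s (restr G)).
Proof.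
case: n G => [|m] G Gm; first by rewrite var_slots_hdiff0 subrr.
rewrite var_slots_hdiff //; exists (- var_slots G); split.
  by apply: multilinear_opp; exact: var_slots_multilinear.
by rewrite hdiffN; move: (var_comm s _) => a; abelian.
Qed.

End OneModule.

Section Naturality.
Variables (M N : lmodType k) (s : bimod_on E E M) (t : bimod_on E E N) (phi : M -> N).
Hypothesis phim : bimod_map s t phi.

Lemma res_map : bimod_map (res_on s) (res_on t) phi.
Proof. by have [pl pL pR] := phim; split=> // *; [apply: pL|apply: pR]. Qed.

Lemma tw_map : bimod_map (tw_on s) (tw_on t) phi.
Proof. by have [pl pL pR] := phim; split=> // *; [apply: pL|apply: pR]. Qed.

Lemma var_comm_map n (f : ('I_n -> A) -> M) :
  var_comm t (phi \o f) = phi \o var_comm s f.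
Proof.
have [pl pL pR] := phim; apply/funext => v.
by rewrite /var_comm /skew_comm /= !(linB pl) pL pR (lin_sum pl).
Qed.

Lemma var_slots_map n (F : ('I_n.+1 -> E) -> M) :
  var_slots (phi \o F) = phi \o var_slots F.
Proof.
have [pl _ _] := phim; apply/funext => v.
rewrite /var_slots /= (lin_sum pl); apply: eq_bigr => i _.
by rewrite (linZ pl).
Qed.

End Naturality.
End OreCochains.

(** * Coordinates on the Ore extension *)

Section Coordinates.
Variables (k : comPzRingType) (A : kAlgType k) (sigma : alg_aut A).
Variables (delta : skew_derivation sigma) (E : ore_extension delta).
Local Notation iota := (ore_incl E).
Local Notation x := (ore_var E).

Lemma coord_ex (e : E) : exists p : nat * (nat -> A),
  e = \sum_(i < p.1) iota (p.2 i) * x ^+ i /\ forall i, (p.1 <= i)%N -> p.2 i = 0.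
Proof.
have [m [c ->]] := ore_gen e.
exists (m, fun i => if (i < m)%N then c i else 0); split=> [|i /=].
  by apply: eq_bigr => i _ /=; rewrite ltn_ord.
by rewrite leqNgt => /negPf ->.
Qed.

Definition ore_coord (e : E) : nat * (nat -> A) := sval (cid (coord_ex e)).
Definition ore_size (e : E) : nat := (ore_coord e).1.
Definition ore_coef (e : E) : nat -> A := (ore_coord e).2.

Lemma ore_coef_default e i : (ore_size e <= i)%N -> ore_coef e i = 0.
Proof. by have [_] := svalP (cid (coord_ex e)); apply. Qed.

Lemma ore_coefK e m : (ore_size e <= m)%N -> \sum_(i < m) iota (ore_coef e i) * x ^+ i = e.
Proof.
move=> le; have [eE _] := svalP (cid (coord_ex e)); rewrite [RHS]eE -/(ore_coord e).
rewrite -!(big_mkord xpredT (fun i => iota (ore_coef e i) * x ^+ i)).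
rewrite (big_cat_nat (leq0n _) le) /= [X in _ + X]big_nat_cond [X in _ + X]big1 ?addr0 //.
by move=> i /andP[/andP[lei _] _]; rewrite ore_coef_default // rmorph0 mul0r.
Qed.

Lemma ore_coef_unique e m (c : nat -> A) :
  e = \sum_(i < m) iota (c i) * x ^+ i -> (forall i, (m <= i)%N -> c i = 0) ->
  ore_coef e =1 c.
Proof.
move=> eE c0 i; pose N := maxn i.+1 (maxn (ore_size e) m).
have cN : \sum_(j < N) iota (c j) * x ^+ j = e.
  rewrite eE -!(big_mkord xpredT (fun i => iota (c i) * x ^+ i)).
  rewrite (@big_cat_nat _ _ _ m 0 N) //=; last by rewrite !leq_max leqnn !orbT.
  rewrite [X in _ + X]big_nat_cond [X in _ + X]big1 ?addr0 //.
  by move=> j /andP[/andP[lej _] _]; rewrite c0 // rmorph0 mul0r.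
apply/eqP; rewrite -subr_eq0; apply/eqP.
apply: (@ore_free _ _ _ _ E N (fun i => ore_coef e i - c i)); last by rewrite leq_max leqnn.
under eq_bigr do rewrite rmorphB mulrBl.
by rewrite big_split /= sumrN cN ore_coefK ?subrr // !leq_max leqnn !orbT.
Qed.

Lemma ore_coef_linear i : linear (ore_coef^~ i).
Proof.
move=> c e e'; pose m := maxn (ore_size e) (ore_size e').
have le : (ore_size e <= m)%N by rewrite leq_maxl.
have le' : (ore_size e' <= m)%N by rewrite leq_maxr.
apply: (@ore_coef_unique _ m (fun i => c *: ore_coef e i + ore_coef e' i)) => [|j lej]; last first.
  by rewrite !ore_coef_default ?scaler0 ?addr0 // (leq_trans _ lej).
rewrite -[in LHS](ore_coefK le) -[in LHS](ore_coefK le') scaler_sumr -big_split /=.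
by apply: eq_bigr => j _; rewrite alg_hom_linear mulrDl kscaleAl.
Qed.

Lemma ore_coef_mono a i j : ore_coef (iota a * x ^+ i) j = if j == i then a else 0.
Proof.
apply: (@ore_coef_unique _ i.+1 (fun j => if j == i then a else 0)) => [|j' lt].
  rewrite (bigD1 ord_max) //= eqxx big1 ?addr0 // => j' ne.
  by rewrite -val_eqE /= in ne; rewrite (negPf ne) rmorph0 mul0r.
by rewrite gtn_eqF.
Qed.

Lemma ore_ext (M : lmodType k) (f g : E -> M) : linear f -> linear g ->
  (forall a i, f (iota a * x ^+ i) = g (iota a * x ^+ i)) -> f =1 g.
Proof.
move=> fl gl h e; rewrite -(ore_coefK (leqnn (ore_size e))) (lin_sum fl) (lin_sum gl).
exact: eq_bigr.
Qed.

Section Lift.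
Variables (M : lmodType k) (psi : nat -> A -> M).
Hypothesis psil : forall i, linear (psi i).

(** The linear map with prescribed values psi i a on the monomials a x^i.  It
    stops at the size of e, and may run further by [coord_liftE] when the psi i
    are linear. *)
Definition coord_lift (e : E) : M := \sum_(i < ore_size e) psi i (ore_coef e i).

Lemma coord_liftE e m : (ore_size e <= m)%N ->
  coord_lift e = \sum_(i < m) psi i (ore_coef e i).
Proof.
move=> le; rewrite /coord_lift -!(big_mkord xpredT (fun i => psi i (ore_coef e i))).
rewrite (big_cat_nat (leq0n _) le) /= [X in _ + X]big_nat_cond [X in _ + X]big1 ?addr0 //.
by move=> i /andP[/andP[lei _] _]; rewrite ore_coef_default // (lin0 (psil i)).
Qed.

Lemma coord_lift_linear : linear coord_lift.
Proof.
move=> c e e'; pose m := maxn (ore_size (c *: e + e')) (maxn (ore_size e) (ore_size e')).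
have le2 : (ore_size e <= m)%N by rewrite !leq_max leqnn orbT.
have le3 : (ore_size e' <= m)%N by rewrite !leq_max leqnn !orbT.
rewrite (coord_liftE (leq_maxl _ _ : _ <= m)%N) (coord_liftE le2) (coord_liftE le3).
rewrite scaler_sumr -big_split /=; apply: eq_bigr => i _.
by rewrite ore_coef_linear psil.
Qed.

Lemma coord_lift_mono a i : coord_lift (iota a * x ^+ i) = psi i a.
Proof.
set e := _ * _; rewrite (coord_liftE (leq_maxl _ i.+1)).
have lt : (i < maxn (ore_size e) i.+1)%N by rewrite leq_max leqnn orbT.
rewrite (bigD1 (Ordinal lt)) //= ore_coef_mono eqxx big1 ?addr0 // => j.
rewrite -val_eqE /= => /negPf ne; rewrite ore_coef_mono ne; exact: lin0.
Qed.

End Lift.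

Section Acyclic.
Variables (M : lmodType k) (s : bimod_on E E M).
Local Notation Q := (coind_on s).

(** E is free as a left A-module, so Hom(E, M) is a product of copies of
    Hom(A, M), each of them acyclic in positive degrees: the primitive moves the coefficient
    of x^i into the last slot and evaluates at x^i.  The left action of A is
    through an arbitrary g to cover the twist by sigma. *)
Lemma coind_restrict_acyclic (g : alg_hom A E) n (f : ('I_n.+1 -> A) -> Lin M E) :
  is_cocycle (restrict_bimod g iota Q) f ->
  exists u, multilinear u /\ hdiff (restrict_bimod g iota Q) u = f.
Proof.
move=> [fm fd]; have /multilinear_curry[cm cl] := fm.
pose psi v i a := sub_val (f (vrcons v a)) (x ^+ i).
have psil v i : linear (psi v i).
  by move=> c a b; have := cl v c a b; rewrite /curry /psi => -> /=.
pose u v := mkLin (coord_lift_linear (psil v)).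
have um : multilinear u.
  move=> v i c a b; apply: sub_val_inj; rewrite /=.
  apply/funext; apply: ore_ext => [|d y z|a' i'].
  - exact: (coord_lift_linear (psil _)).
  - rewrite !(addrfctE, scalrfctE) !(coord_lift_linear (psil _)).
    by rewrite !scalerDr !scalerA (mulrC c); abelian.
  rewrite !(addrfctE, scalrfctE) !coord_lift_mono //.
  have /= := congr1 (fun h => sub_val (h a') (x ^+ i')) (cm v i c a b).
  by [].
exists ((-1) ^+ n.+1 *: u); split; first exact: multilinear_scale.
rewrite hdiffZ; apply/funext => v; rewrite scalrfctE.
suff -> : hdiff (restrict_bimod g iota Q) u v = (-1) ^+ n.+1 *: f v.
  by rewrite scalerA -expr2 sqrr_sign scale1r.
apply: sub_val_inj; apply/funext; apply: ore_ext; [exact: Lin_linear|exact: Lin_linear|].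
move=> c i; rewrite (linZ (@sub_val_linear _ _ _ _)) scalrfctE.
have h := congr1 (fun f => sub_val (f (vrcons v c)) (x ^+ i)) fd.
rewrite hdiffE rdiff_vrcons in h.
have uE w a j : sub_val (u w) (iota a * x ^+ j) = sub_val (f (vrcons w a)) (x ^+ j).
  exact: coord_lift_mono.
have vlin := @sub_val_linear k _ _ (@linear_submod k M E).
rewrite -[LHS]subr0 -[X in _ - X]h /rdiff /hdiff !(addrfctE, opprfctE, scalrfctE) !fct_sumE.
rewrite !(linD vlin) !(lin_sum vlin) !(linZ vlin) !(addrfctE, opprfctE, scalrfctE) !fct_sumE.
have -> : \sum_(j < n) sub_val ((-1) ^+ j.+1 *: u (merge_at j v)) (iota c * x ^+ i) =
    \sum_(j < n) sub_val (((-1) ^+ j.+1 *: curry f (merge_at j v)) c) (x ^+ i).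
  by apply: eq_bigr => j _; rewrite !scalrfctE !(linZ vlin) !scalrfctE uE.
have L1 b q e : sub_val (lact (restrict_bimod g iota Q) b q) e = lact s (g b) (sub_val q e).
  by [].
have R1 b q e : sub_val (ract (restrict_bimod g iota Q) q b) e = sub_val q (iota b * e).
  by [].
rewrite /curry_l /curry_r (linB vlin) !(addrfctE, opprfctE) L1 !R1 L1 mulrA -rmorphM !uE.
have -> : f v = curry f (vinit v) (v ord_max) by rewrite /curry vrcons_eta.
rewrite /curry scalerBr /vtail /vinit; abelian.
Qed.

(** The equation q (x e) = x q e - h e, with q left A-linear, prescribes q on
    the powers of x one after the other, from the free choice q 1 = 0. *)
Lemma coind_var_comm_onto (h : Lin M E) :
  (forall a, lact (tw_on Q) a h = ract (tw_on Q) h a) ->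
  exists q : Lin M E, (forall a, lact (res_on Q) a q = ract (res_on Q) q a) /\
    lact Q x q - ract Q q x = h.
Proof.
move=> hc.
pose fix m i : M := if i is j.+1 then lact s x (m j) - sub_val h (x ^+ j) else 0.
pose psi i a := lact s (iota a) (m i).
have psil i : linear (psi i).
  by move=> c a b; rewrite /psi alg_hom_linear (lact_linearl s (m i)).
exists (mkLin (coord_lift_linear psil)).
have psiE i a : coord_lift psi (iota a * x ^+ i) = lact s (iota a) (m i).
  exact: coord_lift_mono.
split=> [a|]; apply: sub_val_inj; apply/funext; apply: ore_ext => /=.
- by move=> c e e'; rewrite /curry_l (coord_lift_linear psil) (lact_linear s).
- move=> c e e'; rewrite /coind_r mulrDr -kscaleAr.
  by rewrite (coord_lift_linear psil).
- by move=> b i; rewrite /curry_l /coind_r mulrA -rmorphM !psiE rmorphM lactM.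
- move=> c e e'; rewrite !(addrfctE, opprfctE, scalrfctE) /curry_l /coind_r.
  rewrite mulrDr -kscaleAr !(coord_lift_linear psil) (lact_linear s).
  by rewrite scalerBr; abelian.
- exact: Lin_linear.
move=> b i; rewrite !(addrfctE, opprfctE) /curry_l /coind_r psiE mulrA ore_comm mulrDl.
rewrite -mulrA -exprS (linD (coord_lift_linear psil)) !psiE /=.
rewrite (linB (lact_linear s _)) -!lactM ore_comm (linD (lact_linearl s _)) lactM.
have := congr1 (fun q => sub_val q (x ^+ i)) (hc b); rewrite /= /curry_l /coind_r => ->.
abelian.
Qed.

(** Hom(E, M) and its twist are both acyclic in positive degrees.  In total degree
    one, where the second component of a cocycle has degree 0 and need not be a
    coboundary, [coind_var_comm_onto] corrects the primitive of the first. *)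
Lemma coind_cone_acyclic n (y1 : ('I_n.+1 -> A) -> Lin M E) (y2 : ('I_n -> A) -> Lin M E) :
  is_cocycle (res_on Q) y1 -> multilinear y2 -> hdiff (tw_on Q) y2 = var_comm Q y1 ->
  exists f, [/\ multilinear f, hdiff (res_on Q) f = y1 &
    is_coboundary (tw_on Q) (y2 - var_comm Q f)].
Proof.
move=> y1c y2m y21; have [f [fm fd]] := coind_restrict_acyclic y1c.
pose y := y2 - var_comm Q f.
have ym : multilinear y.
  by apply: multilinear_add => //; apply/multilinear_opp/var_comm_multilinear.
have yd : hdiff (tw_on Q) y = 0.
  by rewrite hdiffB y21 -var_comm_hdiff // fd subrr.
case: n y1 y2 y1c y2m y21 f fm fd @y ym yd => [|n] y1 y2 y1c y2m y21 f fm fd y ym yd.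
  pose u : 'I_0 -> A := fun=> 0.
  have [q [qc qh]] := coind_var_comm_onto (arity0_cocycle_central u yd).
  exists (f + fun=> q); split=> [v []//||].
    rewrite hdiffD fd -[RHS]addr0; congr (_ + _); apply/funext => v.
    by rewrite hdiffE (rdiff_arity0 _ _ _ _ u) qc subrr.
  rewrite /= (linD (@var_comm_linear _ _ _ _ _ _ _ _)); apply/funext => v.
  have -> : var_comm Q (fun=> q) = (fun=> y u) :> (('I_0 -> A) -> Lin M E).
    by apply/funext => w; rewrite /var_comm /skew_comm big_ord0 subr0 qh.
  by rewrite /y (vec0 v u) -[RHS]/(0 : Lin M E) !(addrfctE, opprfctE); abelian.
exists f; split=> //; have [g [gm gd]] : exists g, multilinear g /\ hdiff (tw_on Q) g = y.
  exact: coind_restrict_acyclic.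
by exists g.
Qed.

End Acyclic.
End Coordinates.

(** * Comparison of H(E, M) with the cohomology of the cone *)

Section Comparison.
Variables (k : comPzRingType) (A : kAlgType k) (sigma : alg_aut A).
Variables (delta : skew_derivation sigma) (E : ore_extension delta).
Local Notation iota := (ore_incl E).
Local Notation x := (ore_var E).

(** The degree of the pair is n+1.  The second component is a coboundary up to
    the commutator of f, with [is_coboundary] covering the case n = 0, where
    the cochains of degree n - 1 vanish. *)
Definition cone_coboundary (M : lmodType k) (s : bimod_on E E M) n
    (y1 : ('I_n.+1 -> A) -> M) (y2 : ('I_n -> A) -> M) : Prop :=
  exists f, [/\ multilinear f, hdiff (res_on s) f = y1 &
    is_coboundary (tw_on s) (y2 - var_comm s f)].

(** The start of the dimension shift: E is generated by A and x, so what
    commutes with both commutes with E. *)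
Lemma ore_arity0_cocycle (M : lmodType k) (s : bimod_on E E M) (y : ('I_0 -> E) -> M) :
  hdiff (res_on s) (restr y) = 0 -> var_comm s (restr y) = 0 -> hdiff s y = 0.
Proof.
move=> ya yx; pose u : 'I_0 -> E := fun=> 0; pose w : 'I_0 -> A := fun=> 0.
have rE : restr y w = y u by rewrite /restr (vec0 (iota \o w) u).
have ca a : lact s (iota a) (y u) = ract s (y u) (iota a).
  by have := arity0_cocycle_central w ya a; rewrite rE.
have cx : lact s x (y u) = ract s (y u) x.
  have := congr1 (fun z => z w) yx; rewrite /var_comm /skew_comm big_ord0 subr0.
  by rewrite (vec0 (sigma \o w) w) rE => /eqP; rewrite subr_eq0 => /eqP.
apply/funext => v; rewrite hdiffE (rdiff_arity0 _ _ _ _ u); apply/eqP.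
rewrite subr_eq0; apply/eqP; move: (v _).
apply: ore_ext; [exact: lact_linearl|exact: ract_linearr|move=> a i].
rewrite lactM ractM -ca lractA; congr lact.
by elim: i => [|i IH]; rewrite ?expr0 ?lact1 ?ract1 // exprS lactM ractM IH -lractA cx.
Qed.

(** Dimension shift: lift F to a primitive U in Hom(E, M).  Correcting the
    image of U in the cone by a primitive of the image of F gives a cocycle of
    the acyclic cone of Hom(E, M), so the class of U in the cone of M' is zero,
    and there the claim is known one degree lower. *)
Lemma comparison_inj n (M : lmodType k) (s : bimod_on E E M) (F : ('I_n.+1 -> E) -> M) :
  is_cocycle s F -> cone_coboundary s (restr F) (var_slots F) -> is_coboundary s F.
Proof.
elim: n M s F => [|n IH] M s F Fc [f [fm fd fx]].
  have [U [Um Ud]] := coind_primitive Fc.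
  have im := coind_incl_map s; have [il _ _] := im.
  pose f' : ('I_0 -> E) -> M := fun=> f (fun=> 0).
  have rf : restr f' = f by apply/funext => v; rewrite /restr /f' (vec0 v (fun=> 0)).
  exists f'; split; first by move=> v [].
  apply/funext => v; apply: (can_inj (coind_inclK s)).
  rewrite -[LHS]/((coind_incl s \o F) v) -Ud.
  rewrite -[RHS]/((coind_incl s \o hdiff s f') v) -(hdiff_map im); congr (_ v).
  apply/eqP; rewrite -subr_eq0 -hdiffB; apply/eqP; apply: ore_arity0_cocycle.
    rewrite restr_hdiff hdiffB Ud (hdiff_map im) -(postB il) /=.
    rewrite -[RHS](post0 _ il) /restr; apply/funext => w /=; congr (coind_incl s _).
    move: fd; rewrite -rf restr_hdiff => /(congr1 (fun z => z w)) e.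
    by rewrite !(addrfctE, opprfctE) [X in _ - X]e subrr.
  rewrite -var_slots_hdiff0 hdiffB Ud (hdiff_map im) -(postB il) (var_slots_map im).
  rewrite (linB (@var_slots_linear _ _ _ _ E _ _)) var_slots_hdiff0 rf.
  by move: fx => /= ->; rewrite (post0 _ il).
have [U [Um Ud]] := coind_primitive Fc.
have im := coind_incl_map s; have [il _ _] := im.
have pm := coind_proj_map s; have [pl _ _] := pm.
have [g [gm gd]] : exists g, multilinear g /\
    var_slots F - var_comm s f = hdiff (tw_on s) g by [].
pose y1 := restr U - (coind_incl s \o f); pose y2 := var_slots U + (coind_incl s \o g).
have y1c : is_cocycle (res_on (coind_on s)) y1.
  split.
    apply: multilinear_add; first exact: restr_multilinear.
    by apply: multilinear_opp; exact: multilinear_post.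
  rewrite hdiffB restr_hdiff Ud (hdiff_map (res_map im)) fd.
  exact: subrr.
have y2m : multilinear y2.
  apply: multilinear_add; first exact: var_slots_multilinear.
  exact: multilinear_post.
have y21 : hdiff (tw_on (coind_on s)) y2 = var_comm (coind_on s) y1.
  rewrite hdiffD (hdiff_map (tw_map im)) -gd (linB (@var_comm_linear _ _ _ _ _ _ _ _)).
  rewrite (var_comm_map im) (postB il) -(var_slots_map im) -Ud var_slots_hdiff //; abelian.
have [h [hm hd hx]] := coind_cone_acyclic y1c y2m y21.
have pUc : is_cocycle (coind0_on s) (coind_proj s \o U).
  by split; [exact: multilinear_post|rewrite (hdiff_map pm) Ud post_proj_incl].
have /(_ _)/= := IH _ _ _ pUc; case.
  exists (coind_proj s \o h); split; first exact: multilinear_post.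
    by rewrite (hdiff_map (res_map pm)) hd /y1 (postB pl) post_proj_incl subr0.
  have := coboundary_map (tw_map pm) hx.
  rewrite (postB pl) /y2 (postD pl) post_proj_incl addr0.
  by rewrite (var_comm_map pm) (var_slots_map pm).
(* U is d V modulo M, hence differs from a coboundary by a cochain in M,
   which is a primitive of F. *)
move=> V [Vm Vd]; pose W := U - hdiff (coind_on s) (@coind_sec k E M \o V).
have sm : multilinear (@coind_sec k E M \o V).
  by apply: multilinear_post => //; exact: coind_sec_linear.
have Wm : multilinear W.
  by apply: multilinear_add => //; apply/multilinear_opp/hdiff_multilinear.
have pW : coind_proj s \o W = 0.
  by rewrite (postB pl) -(hdiff_map pm) post_proj_sec Vd subrr.
exists (@coind_ev k E M \o W); split.
  by apply: multilinear_post => //; exact: coind_ev_linear.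
apply: (@post_incl_inj _ _ _ s); rewrite -(hdiff_map im) post_proj_eq0 //.
by rewrite hdiffB hdiff_hdiff subr0 Ud.
Qed.

(** The dual dimension shift: a cocycle of the cone of M has a primitive in the
    acyclic cone of Hom(E, M); its image in the cone of M' comes, up to a
    coboundary, from a cocycle V over E by induction, and F is the connecting
    map applied to V. *)
Lemma comparison_surj n (M : lmodType k) (s : bimod_on E E M)
    (y1 : ('I_n.+1 -> A) -> M) (y2 : ('I_n -> A) -> M) :
  is_cocycle (res_on s) y1 -> multilinear y2 ->
  hdiff (tw_on s) y2 = var_comm s y1 ->
  exists F, is_cocycle s F /\ cone_coboundary s (y1 - restr F) (y2 - var_slots F).
Proof.
elim: n M s y1 y2 => [|n IH] M s y1 y2 y1c y2m y21;
  have im := coind_incl_map s; have [il _ _] := im;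
  have pm := coind_proj_map s; have [pl _ _] := pm;
  have iy1 := cocycle_map_post (res_map im) y1c;
  have [|h [hm hd hx]] := coind_cone_acyclic iy1 (multilinear_post il y2m);
    try by rewrite (hdiff_map (tw_map im)) y21 (var_comm_map im).
  pose t : ('I_0 -> E) -> Lin M E := fun=> h (fun=> 0).
  have rt : restr t = h by apply/funext => v; rewrite /restr /t (vec0 v (fun=> 0)).
  have iy2 : var_comm (coind_on s) h = coind_incl s \o y2.
    by apply/esym/eqP; rewrite -subr_eq0; apply/eqP.
  have ptd : hdiff (coind0_on s) (coind_proj s \o t) = 0.
    apply: ore_arity0_cocycle; rewrite -[restr _]/(coind_proj s \o restr t) rt.
      by rewrite (hdiff_map (res_map pm)) hd post_proj_incl.
    by rewrite (var_comm_map pm) iy2 post_proj_incl.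
  have tm : multilinear t by move=> v [].
  pose F := @coind_ev k E M \o hdiff (coind_on s) t.
  have iF : coind_incl s \o F = hdiff (coind_on s) t.
    by apply: post_proj_eq0; rewrite -(hdiff_map pm).
  exists F; split; last first.
    have e1 : y1 = restr F.
      apply: (@post_incl_inj _ _ _ s); rewrite -hd -rt restr_hdiff -iF.
      by [].
    have e2 : y2 = var_slots F.
      apply: (@post_incl_inj _ _ _ s).
      by rewrite -(var_slots_map im) iF var_slots_hdiff0 rt iy2.
    exists 0; rewrite -e1 -e2 !subrr; split; first exact: multilinear0.
      exact: hdiff0.
    by rewrite (lin0 (@var_comm_linear _ _ _ _ _ _ _ _)) subrr; exact: coboundary0.
  split.
    apply: multilinear_post; first exact: coind_ev_linear.
    exact: hdiff_multilinear.
  apply: (@post_incl_inj _ _ _ s); rewrite -(hdiff_map im) iF hdiff_hdiff.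
  by rewrite (post0 _ il).
have [t2 [t2m t2d]] : exists t2, multilinear t2 /\
    (coind_incl s \o y2) - var_comm (coind_on s) h = hdiff (tw_on (coind_on s)) t2 by [].
have pt2 : hdiff (tw_on (coind0_on s)) (- (coind_proj s \o t2)) =
    var_comm (coind0_on s) (coind_proj s \o h).
  rewrite hdiffN (hdiff_map (tw_map pm)) -t2d (postB pl) post_proj_incl sub0r opprK.
  by rewrite (var_comm_map pm).
have hc : is_cocycle (res_on (coind0_on s)) (coind_proj s \o h).
  split; first exact: multilinear_post.
  by rewrite (hdiff_map (res_map pm)) hd post_proj_incl.
have pt2m := multilinear_opp (multilinear_post pl t2m).
have [V [[Vm Vd] [f [fm fd fx]]]] := IH _ _ _ _ hc pt2m pt2.
have sl := @coind_sec_linear k E M; have el := @coind_ev_linear k E M.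
(* SV lifts V, and Z, T are the components of the difference between the
   primitive (h, - t2) and the image of SV, up to the lift sf of the primitive
   in the cone of M'. *)
pose SV := @coind_sec k E M \o V; have SVm : multilinear SV by exact: multilinear_post.
pose sf := @coind_sec k E M \o f; have sfm : multilinear sf by exact: multilinear_post.
pose F := @coind_ev k E M \o hdiff (coind_on s) SV.
have iF : coind_incl s \o F = hdiff (coind_on s) SV.
  by apply: post_proj_eq0; rewrite -(hdiff_map pm) post_proj_sec.
pose Z := h - restr SV - hdiff (res_on (coind_on s)) sf.
have Zm : multilinear Z.
  apply: multilinear_add; last by apply/multilinear_opp/hdiff_multilinear.
  by apply: multilinear_add => //; apply/multilinear_opp/restr_multilinear.
have iZ : coind_incl s \o (@coind_ev k E M \o Z) = Z.
  apply: post_proj_eq0; rewrite !(postB pl) -(hdiff_map (res_map pm)) [coind_proj s \o sf]post_proj_sec fd.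
  by rewrite -[coind_proj s \o restr SV]/(restr (coind_proj s \o SV)) post_proj_sec subrr.
pose T := - t2 - var_slots SV - var_comm (coind_on s) sf.
have Tm : multilinear T.
  apply: multilinear_add; last by apply/multilinear_opp/var_comm_multilinear.
  apply: multilinear_add; first exact: multilinear_opp.
  by apply/multilinear_opp/var_slots_multilinear.
have [|T0 [T0m T0d]] := coind_descend (tw_map im) (tw_map pm) Tm.
  rewrite /T 2!(postB pl) -(var_slots_map pm) -(var_comm_map pm) !post_proj_sec.
  suff -> : coind_proj s \o - t2 = - (coind_proj s \o t2) by [].
  by apply/funext => v; exact: linN pl (t2 v).
exists F; split.
  split; first by apply: multilinear_post => //; exact: hdiff_multilinear.
  apply: (@post_incl_inj _ _ _ s); rewrite -(hdiff_map im) iF hdiff_hdiff.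
  by rewrite (post0 _ il).
exists (@coind_ev k E M \o Z); split; first exact: multilinear_post.
  apply: (@post_incl_inj _ _ _ s); rewrite -(hdiff_map (res_map im)) iZ !hdiffB hdiff_hdiff.
  by rewrite subr0 hd restr_hdiff -iF (postB il).
exists (- T0); split; first exact: multilinear_opp.
apply: (@post_incl_inj _ _ _ s); rewrite hdiffN.
have -> : coind_incl s \o - hdiff (tw_on s) T0 = - hdiff (tw_on (coind_on s)) T.
  by rewrite T0d; apply/funext => v; exact: linN il _.
rewrite 2!(postB il) -(var_slots_map im) -(var_comm_map im) iF iZ.
rewrite var_slots_hdiff // !(linB (@var_comm_linear _ _ _ _ _ _ _ _)) var_comm_hdiff //.
by rewrite !hdiffB hdiffN -t2d; abelian.
Qed.

End Comparison.

(** * Representing cocycles through a projective resolution *)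

Section MultilinearLift.
Variables (k : comPzRingType).

Lemma linear_pack (U V : lmodType k) (f : U -> V) : linear f ->
  exists g : {linear U -> V}, g =1 f.
Proof.
by move=> fl; exists (HB.pack_for {linear U -> V} f (GRing.isLinear.Build k U V *:%R f fl)).
Qed.

Lemma projective_lift (P M N : lmodType k) (p : M -> N) (f : P -> N) :
  projective_module P -> linear p -> linear f -> (forall y, exists m, p m = y) ->
  exists g, linear g /\ p \o g = f.
Proof.
move=> hP /linear_pack[p' pE] /linear_pack[f' fE] ps.
have [|g gE] := hP _ _ p' f'; first by move=> y; have [m <-] := ps y; exists m; rewrite pE.
exists g; split; first exact: linearP.
by apply/funext => z; rewrite /= -pE gE fE.
Qed.

Variable A : kAlgType k.
Hypothesis hA : projective_module A.

(** Currying the last argument: by projectivity of A the linear maps from A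
    to M map onto those to N, and the remaining arguments lift by induction.
    This replaces the projectivity of the tensor powers of A. *)
Lemma multilinear_lift n (M N : lmodType k) (p : M -> N) (f : ('I_n -> A) -> N) :
  linear p -> (forall y, exists m, p m = y) -> multilinear f ->
  exists g, multilinear g /\ p \o g = f.
Proof.
elim: n M N p f => [|n IH] M N p f pl ps fm.
  have [m mE] := ps (f (fun=> 0)); exists (fun=> m); split; first by move=> v [].
  by apply/funext => v; rewrite /= mE (vec0 v (fun=> 0)).
have /multilinear_curry[cm cl] := fm.
have pql (q : Lin M A) : linear (p \o sub_val q).
  by move=> c x y /=; rewrite Lin_linear pl.
pose f' v := mkLin (cl v); pose p' q := mkLin (pql q).
have [|q||g' [gm gE]] := IH (Lin M A) (Lin N A) p' f'.
- by move=> c x y; apply: sub_val_inj; apply/funext => a; rewrite /= !fctE pl.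
- have [g [gl gE]] := projective_lift hA pl (Lin_linear q) ps.
  by exists (mkLin gl); apply: sub_val_inj.
- by move=> v i c x y; apply: sub_val_inj; exact: cm.
exists (fun v => sub_val (g' (vinit v)) (v ord_max)); split; last first.
  apply/funext => v /=.
  have := congr1 (fun h => sub_val (h (vinit v)) (v ord_max)) gE.
  by rewrite /= /curry vrcons_eta.
apply/multilinear_curry.
have -> : curry (fun v => sub_val (g' (vinit v)) (v ord_max)) = fun v => sub_val (g' v).
  by apply/funext => v; apply/funext => c; rewrite /curry vinit_vrcons vrcons_max.
split; last by move=> v; exact: Lin_linear.
by apply: (multilinear_post _ gm); exact: sub_val_linear.
Qed.

Lemma multilinear_lift_image n (M N : lmodType k) (p : M -> N) (f : ('I_n -> A) -> N) :
  linear p -> (forall v, exists m, p m = f v) -> multilinear f ->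
  exists g, multilinear g /\ p \o g = f.
Proof.
move=> pl pf fm; pose I (y : N) : bool := `[< exists m, p m = y >].
have Isub : submod_closed I.
  split; first by apply/asboolP; exists 0; exact: lin0.
  move=> c y z /asboolP[m <-] /asboolP[m' <-]; apply/asboolP.
  by exists (c *: m + m'); rewrite pl.
have pI m : I (p m) by apply/asboolP; exists m.
pose f' v := SubMod Isub (asboolT (pf v) : I (f v)); pose p' m := SubMod Isub (pI m).
have [|y||g [gm gE]] := @multilinear_lift n M (sub_mod Isub) p' f'.
- by move=> c x y; apply: sub_val_inj; rewrite /= pl.
- have /asboolP[m mE] := sub_valP y; exists m; exact: sub_val_inj.
- by move=> v i c x y; apply: sub_val_inj; exact: fm.
exists g; split=> //; apply/funext => v.
exact: (congr1 (fun h => sub_val (h v)) gE).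
Qed.

End MultilinearLift.

Section ResolutionComparison.
Variables (k : comPzRingType) (A : kAlgType k).
Hypothesis hA : projective_module A.

Lemma projective_bimodule_lift (P : bimodule A A) (M N : lmodType k)
    (s : bimod_on A A M) (t : bimod_on A A N) (p : M -> N) (f : P -> N) :
  projective_bimodule P -> bimod_map s t p -> (forall y, exists m, p m = y) ->
  bimod_map (bimod_str P) t f -> exists g, bimod_map (bimod_str P) s g /\ p \o g = f.
Proof.
move=> hP [pl pL pR] ps [fl fL fR].
have [p' pE] := linear_pack pl; have [f' fE] := linear_pack fl.
have p'L b m : p' (lact s b m) = lact t b (p' m) by rewrite !pE.
have p'R m b : p' (ract s m b) = ract t (p' m) b by rewrite !pE.
have f'L b m : f' (lact (bimod_str P) b m) = lact t b (f' m) by rewrite !fE.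
have f'R m b : f' (ract (bimod_str P) m b) = ract t (f' m) b by rewrite !fE.
have [|g gE] := hP (Bimodule s) (Bimodule t) (@BimodHom _ _ _ (Bimodule s) (Bimodule t) p' p'L p'R)
  (@BimodHom _ _ _ P (Bimodule t) f' f'L f'R).
  by move=> y; have [m <-] := ps y; exists m; rewrite /= pE.
exists g; split; last by apply/funext => z; rewrite /= -pE -fE; exact: gE.
by split; [exact: linearP|exact: (bhom_lact g)|exact: (bhom_ract g)].
Qed.

Variables (P : nat -> bimodule A A) (d : forall i, bimod_hom (P i.+1) (P i))
  (eps : bimod_hom (P 0%N) (regular_bimodule A)).
Hypotheses (projP : forall i, projective_bimodule (P i))
  (eps_onto : forall b, exists y, eps y = b) (exact0 : exact_at (d 0%N) eps)
  (exactS : forall i, exact_at (d i.+1) (d i)).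

Lemma bhom_map (B C : kAlgType k) (M N : bimodule B C) (f : bimod_hom M N) :
  bimod_map (bimod_str M) (bimod_str N) f.
Proof. by split; [exact: linearP|exact: bhom_lact|exact: bhom_ract]. Qed.

(** alpha is the degree n part of a chain map from the bar resolution to P;
    the second condition is what allows its continuation.  Every cocycle z
    factors through it up to a coboundary: for n = 0 through the augmentation,
    and in higher degrees by dimension shifting, where projectivity of P n
    lifts a map from P n to M' to one to Hom(A, M). *)
Lemma resolution_represents n :
  exists alpha : ('I_n -> A) -> P n,
  [/\ multilinear alpha,
      forall v, exists y, d n y = hdiff (bimod_str (P n)) alpha v
    & forall (M : lmodType k) (s : bimod_on A A M) (z : ('I_n -> A) -> M),
        is_cocycle s z -> exists w : P n -> M,
        [/\ bimod_map (bimod_str (P n)) s w, forall y, w (d n y) = 0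
          & is_coboundary s (z - (w \o alpha))]].
Proof.
elim: n => [|n [alpha [am ad aw]]].
  have [p0 p01] := eps_onto 1; pose u : 'I_0 -> A := fun=> 0.
  exists (fun=> p0); split=> [v []//|v|M s z [zm zd]].
    apply/exact0; rewrite hdiffE (rdiff_arity0 _ _ _ _ u) (linB (linearP eps)).
    by rewrite bhom_lact bhom_ract p01 /= mulr1 mul1r subrr.
  have zc := arity0_cocycle_central u zd.
  exists (fun y => lact s (eps y) (z u)); split=> [|y|].
  - split=> [c x y|b m|m b]; first by rewrite (linearP eps) (lact_linearl s (z u)).
      by rewrite bhom_lact lactM.
    by rewrite bhom_ract /= lactM zc lractA.
  - by rewrite (_ : eps _ = 0) ?(lin0 (lact_linearl s _)) //; apply/exact0; exists y.
  rewrite (_ : z - _ = 0) /=; first by [].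
  by apply/funext => v; rewrite !(addrfctE, opprfctE) /= p01 lact1 (vec0 v u) subrr.
have [al' [a'm a'd]] := multilinear_lift_image hA (linearP (d n)) ad (hdiff_multilinear _ am).
exists al'; split=> // [v|M s z zc].
  apply/exactS; rewrite -[LHS]/((d n \o hdiff _ al') v) -(hdiff_map (bhom_map (d n))) a'd.
  by rewrite hdiff_hdiff.
have [U [Um Ud]] := coind_primitive zc.
have im := coind_incl_map s; have [il _ _] := im.
have pm := coind_proj_map s; have [pl _ _] := pm.
have pUc : is_cocycle (coind0_on s) (coind_proj s \o U).
  by split; [exact: multilinear_post|rewrite (hdiff_map pm) Ud post_proj_incl].
have [w' [w'm w'd w'x]] := aw _ _ _ pUc.
have ps : forall y, exists q, coind_proj s q = y.
  by move=> y; exists (coind_sec y); exact: coind_secK.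
have [w2 [w2m w2E]] := projective_bimodule_lift (@projP n) pm ps w'm.
have [w2l w2L w2R] := w2m.
pose T := U - (w2 \o alpha).
have Tm : multilinear T.
  by apply: multilinear_add => //; apply/multilinear_opp/multilinear_post.
have [|T0 [T0m T0d]] := coind_descend im pm Tm.
  by rewrite (postB pl) -[coind_proj s \o (w2 \o alpha)]/((coind_proj s \o w2) \o alpha) w2E.
(* w' kills the boundaries, so its lift w2 sends them into M. *)
pose w := @coind_ev k A M \o (w2 \o d n).
have iw : coind_incl s \o w = w2 \o d n.
  apply: post_proj_eq0; rewrite -[coind_proj s \o _]/((coind_proj s \o w2) \o d n) w2E.
  by apply/funext => y; exact: w'd.
have iwE y : coind_incl s (w y) = w2 (d n y) := congr1 (fun h => h y) iw.
have [_ iL iR] := im.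
exists w; split=> [|y|].
- split=> [c x y|b m|m b]; apply: (can_inj (coind_inclK s)).
  + by rewrite il !iwE (linearP (d n)) w2l.
  + by rewrite iL !iwE bhom_lact w2L.
  + by rewrite iR !iwE bhom_ract w2R.
- apply: (can_inj (coind_inclK s)); rewrite iwE (_ : d n _ = 0).
    by rewrite (lin0 w2l) (lin0 il).
  by apply/exactS; exists y.
exists T0; split=> //; apply: (@post_incl_inj _ _ _ s).
rewrite -T0d /T hdiffB Ud (hdiff_map w2m) (postB il).
congr (_ - _); rewrite -a'd.
by rewrite -[LHS]/((coind_incl s \o w) \o al') iw.
Qed.

End ResolutionComparison.

(** The values of w \o alpha lie in the sub-bimodule generated by the images
    under w of finitely many generators of P n. *)
Lemma fg_cocycle (k : comPzRingType) (A : kAlgType k) (M : lmodType k)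
    (s : bimod_on A A M) n (z : ('I_n -> A) -> M) :
  projective_module A -> has_fg_projective_resolution A -> is_cocycle s z ->
  exists (r : nat) (m : 'I_r -> M) (z' : ('I_n -> A) -> M),
  [/\ is_cocycle s z', is_coboundary s (z - z') & forall v, exists t : seq (A * 'I_r * A),
    z' v = \sum_(p <- t) lact s p.1.1 (ract s (m p.1.2) p.2)].
Proof.
move=> hA [P [d [eps [pf e_onto e0 eS]]]] zc.
have [alpha [am ad aw]] := resolution_represents hA (fun i => (pf i).1) e_onto e0 eS n.
have [w [[wl wL wR] wd wx]] := aw _ _ _ zc; have [_ [r [e eE]]] := pf n.
exists r, (w \o e), (w \o alpha); split=> // [|v].
  have /coboundary_cocycle[xm xd] := wx; have [zm zd] := zc.
  split; first exact: multilinear_post.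
  apply/eqP; rewrite -oppr_eq0; apply/eqP; rewrite -xd hdiffB zd.
  by rewrite sub0r.
have [t tE] := eE (alpha v); exists t; rewrite /= tE (lin_sum wl).
by apply: eq_bigr => p _; rewrite wL wR.
Qed.

(** * Injectivity of the commutator for coefficients in the tensor square *)

Section LeadingCoefficient.
Variables (k : comPzRingType) (A : kAlgType k) (sigma : alg_aut A).
Variables (delta : skew_derivation sigma) (E : ore_extension delta).
Local Notation iota := (ore_incl E).
Local Notation x := (ore_var E).
Local Notation EE := (tensor E E).
Local Notation out := (outer_on E).

Lemma ore_mono_linear i : linear (fun a => iota a * x ^+ i).
Proof. by move=> c a b; rewrite alg_hom_linear mulrDl kscaleAl. Qed.

Lemma truncf_linear N i : linear (fun a => if (i < N)%N then iota a * x ^+ i else 0).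
Proof. by move=> c a b; case: ifP => _; rewrite ?ore_mono_linear // scaler0 addr0. Qed.

Lemma topf_linear N i :
  linear (fun a => if i == N.+1 then iota (aut_inv sigma a) * x ^+ N else 0).
Proof.
move=> c a b; case: ifP => _; last by rewrite scaler0 addr0.
by rewrite alg_hom_linear ore_mono_linear.
Qed.

(** Both maps are defined on left coordinates, so they commute with the left
    action of A, [top_shift] up to sigma.  [top_shift N] inverts multiplication
    by x on the part of degree N: it extracts the coefficient of x^(N+1) and
    undoes sigma. *)
Definition trunc N : E -> E :=
  coord_lift (fun i a => if (i < N)%N then iota a * x ^+ i else 0).

Definition top_shift N : E -> E :=
  coord_lift (fun i a => if i == N.+1 then iota (aut_inv sigma a) * x ^+ N else 0).

Lemma trunc_linear N : linear (trunc N).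
Proof. exact: coord_lift_linear (truncf_linear N). Qed.

Lemma top_shift_linear N : linear (top_shift N).
Proof. exact: coord_lift_linear (topf_linear N). Qed.

Lemma trunc_mono N a i : trunc N (iota a * x ^+ i) = if (i < N)%N then iota a * x ^+ i else 0.
Proof. by rewrite /trunc coord_lift_mono // => j; exact: truncf_linear. Qed.

Lemma top_shift_mono N a i : top_shift N (iota a * x ^+ i) =
  if i == N.+1 then iota (aut_inv sigma a) * x ^+ N else 0.
Proof. by rewrite /top_shift coord_lift_mono // => j; exact: topf_linear. Qed.

Lemma trunc_id N e : (ore_size e <= N)%N -> trunc N e = e.
Proof.
move=> le; rewrite -[RHS](ore_coefK (leqnn _)) /trunc /coord_lift.
by apply: eq_bigr => i _; rewrite (leq_trans (ltn_ord i) le).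
Qed.

Let idl : linear (@id E). Proof. by []. Qed.

Definition trunc_left N : EE -> EE := tmap (trunc_linear N) idl.
Definition top_left N : EE -> EE := tmap (top_shift_linear N) idl.

Lemma trunc_left_linear N : linear (trunc_left N).
Proof. exact: tmap_linear. Qed.
Lemma top_left_linear N : linear (top_left N).
Proof. exact: tmap_linear. Qed.

Lemma tensor_ore_ext (W : lmodType k) (f g : EE -> W) : linear f -> linear g ->
  (forall a i e, f (tpure (iota a * x ^+ i) e) = g (tpure (iota a * x ^+ i) e)) -> f =1 g.
Proof.
move=> fl gl h; apply: tensor_lift_unique => // u v; have [tl _] := tpure_bilinear E E.
move: u; apply: (@ore_ext _ _ _ _ E _ (fun u => f (tpure u v)) (fun u => g (tpure u v))).
- by move=> c a b; rewrite tl fl.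
- by move=> c a b; rewrite tl gl.
- by move=> a i; exact: h.
Qed.

Lemma tpure0l (u : E) : tpure 0 u = 0 :> EE.
Proof. by have [tl _] := tpure_bilinear E E; exact: (lin0 (tl u)). Qed.

Lemma tpureBl (a b u : E) : tpure (a - b) u = tpure a u - tpure b u :> EE.
Proof. by have [tl _] := tpure_bilinear E E; exact: (linB (tl u)). Qed.

Lemma trunc_leftE N u v : trunc_left N (tpure u v) = tpure (trunc N u) v.
Proof. exact: tmapE. Qed.
Lemma top_leftE N u v : top_left N (tpure u v) = tpure (top_shift N u) v.
Proof. exact: tmapE. Qed.

Lemma trunc_left_map N : bimod_map (res_on out) (res_on out) (trunc_left N).
Proof.
have tl := trunc_left_linear N.
split=> // [b m|m c].
- move: m; apply: tensor_ore_ext.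
  + by move=> c t t'; rewrite (lact_linear _ b) tl.
  + by move=> c t t'; rewrite tl (lact_linear _ b).
  move=> a i e; rewrite /= !(tmapE, trunc_leftE, top_leftE). rewrite trunc_mono mulrA -rmorphM trunc_mono.
  by case: ifP => _; rewrite ?mulr0 // mulrA -rmorphM.
- move: m; apply: tensor_ore_ext.
  + by move=> d t t'; rewrite (ract_linear _ c) tl.
  + by move=> d t t'; rewrite tl (ract_linear _ c).
  by move=> a i e; rewrite /= !(tmapE, trunc_leftE, top_leftE).
Qed.

(** The source carries the twisted structure: [top_shift] undoes the sigma that
    multiplication by x has introduced. *)
Lemma top_left_map N : bimod_map (tw_on out) (res_on out) (top_left N).
Proof.
have tl := top_left_linear N.
split=> // [b m|m c].
- move: m; apply: tensor_ore_ext.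
  + by move=> c t t'; rewrite (lact_linear _ b) tl.
  + by move=> c t t'; rewrite tl (lact_linear _ b).
  move=> a i e; rewrite /= !(tmapE, trunc_leftE, top_leftE) mulrA -rmorphM !top_shift_mono rmorphM autK.
  by case: ifP => _; rewrite ?mulr0 // mulrA -rmorphM.
- move: m; apply: tensor_ore_ext.
  + by move=> d t t'; rewrite (ract_linear _ c) tl.
  + by move=> d t t'; rewrite tl (ract_linear _ c).
  by move=> a i e; rewrite /= !(tmapE, trunc_leftE, top_leftE).
Qed.

Lemma top_left_ract N t b : top_left N (ract out t b) = ract out (top_left N t) b.
Proof.
have tl := top_left_linear N; move: t; apply: tensor_ore_ext.
- by move=> d t t'; rewrite (ract_linear _ b) tl.
- by move=> d t t'; rewrite tl (ract_linear _ b).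
by move=> a i e; rewrite /= !(tmapE, trunc_leftE, top_leftE).
Qed.

Lemma trunc_left0 t : trunc_left 0 t = 0.
Proof.
move: t; apply: tensor_ore_ext; first exact: trunc_left_linear.
  by move=> c u v; rewrite scaler0 addr0.
by move=> a i e; rewrite trunc_leftE trunc_mono tpure0l.
Qed.

Lemma trunc_left_le N N' t : (N <= N')%N ->
  trunc_left N' (trunc_left N t) = trunc_left N t.
Proof.
move=> le; have tl := trunc_left_linear; move: t; apply: tensor_ore_ext => //.
  by move=> c u v; rewrite !tl.
move=> a i e; rewrite !(tmapE, trunc_leftE, top_leftE) trunc_mono; case: ifP => lt.
  by rewrite trunc_mono (leq_trans lt le).
by rewrite (lin0 (trunc_linear N')).
Qed.

Lemma top_left_trunc N t : top_left N (trunc_left N.+1 t) = 0.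
Proof.
have tl := trunc_left_linear; have pl := top_left_linear.
move: t; apply: tensor_ore_ext.
- by move=> c u v; rewrite tl pl.
- by move=> c u v; rewrite scaler0 addr0.
move=> a i e; rewrite !(tmapE, trunc_leftE, top_leftE) trunc_mono; case: ifP => lt.
  by rewrite top_shift_mono ltn_eqF // tpure0l.
by rewrite (lin0 (top_shift_linear N)) tpure0l.
Qed.

(** Multiplication by x followed by [top_left N] is the projection to left
    degree N, on elements of left degree at most N: the terms with delta stay
    in degree at most N. *)
Lemma top_left_var N t :
  top_left N (lact out x (trunc_left N.+1 t)) = trunc_left N.+1 t - trunc_left N t.
Proof.
have tl := trunc_left_linear; have pl := top_left_linear.
move: t; apply: tensor_ore_ext.
- by move=> c u v; rewrite tl (lact_linear out) pl.
- by move=> c u v; rewrite !tl scalerBr; abelian.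
move=> a i e; rewrite /= !(tmapE, trunc_leftE, top_leftE) !trunc_mono -tpureBl ltnS leq_eqVlt.
have [->|ne] /= := eqVneq i N.
  rewrite ltnn subr0 mulrA ore_comm mulrDl -mulrA -exprS (linD (top_shift_linear N)).
  by rewrite !top_shift_mono eqxx ltn_eqF // addr0 autK.
case: ifP => lt; last by rewrite mulr0 (lin0 (top_shift_linear N)) subrr.
rewrite subrr mulrA ore_comm mulrDl -mulrA -exprS (linD (top_shift_linear N)).
by rewrite !top_shift_mono eqSS (negPf ne) ltn_eqF ?addr0 // ltnW.
Qed.

Lemma trunc_left_bound (t : EE) : exists N, forall N', (N <= N')%N -> trunc_left N' t = t.
Proof.
have tl := trunc_left_linear; have [s ->] := tensor_sum t; elim: s => [|p s [N IH]].
  by exists 0%N => N' _; rewrite big_nil (lin0 (tl N')).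
exists (maxn N (ore_size p.1)) => N'; rewrite geq_max => /andP[l1 l2].
by rewrite big_cons (linD (tl N')) IH // trunc_leftE trunc_id.
Qed.

(** [top_left N] maps the commutator of z to the part of z of left degree N, so
    that this part is a coboundary.  Subtracting it lowers the degree bound. *)
Lemma bounded_var_comm_inj n N (z : ('I_n -> A) -> EE) :
  is_cocycle (res_on out) z -> (forall v, trunc_left N (z v) = z v) ->
  is_coboundary (tw_on out) (var_comm out z) -> is_coboundary (res_on out) z.
Proof.
elim: N z => [|N IH] z zc zN zx.
  suff -> : z = 0 by exact: coboundary0.
  by apply/funext => v; rewrite -zN trunc_left0.
have pl := top_left_linear N.
have top0 v : top_left N (z v) = 0 by rewrite -zN top_left_trunc.
have yE : top_left N \o var_comm out z = z - (trunc_left N \o z).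
  apply/funext => v; transitivity (top_left N (lact out x (z v)) -
    top_left N (ract out (z (sigma \o v)) x) - \sum_(i < n) top_left N (z (mix delta i v))).
    by rewrite -(lin_sum pl) -!(linB pl).
  rewrite top_left_ract top0 (lin0 (ract_linear out x)) big1 => [|i _]; last exact: top0.
  by rewrite !subr0 -[z v in LHS]zN top_left_var zN.
have yc := coboundary_map (top_left_map N) zx; rewrite yE in yc.
rewrite -[z](subrK (trunc_left N \o z)); apply: coboundaryD => //; apply: IH.
- exact: (cocycle_map_post (trunc_left_map N) zc).
- by move=> v; exact: trunc_left_le.
have -> : trunc_left N \o z = z - (z - (trunc_left N \o z)) by rewrite subKr.
rewrite (linB (@var_comm_linear _ _ _ _ E _ _ _)); apply: coboundaryB => //.
exact: var_comm_coboundary.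
Qed.

(** This is where the finiteness of the resolution enters: the finitely many
    generators of [fg_cocycle] have a common degree bound. *)
Lemma var_comm_inj n (z : ('I_n -> A) -> EE) :
  projective_module A -> has_fg_projective_resolution A ->
  is_cocycle (res_on out) z ->
  is_coboundary (tw_on out) (var_comm out z) -> is_coboundary (res_on out) z.
Proof.
move=> hA hres zc zx; have [r [m [z' [z'c zz' z'E]]]] := fg_cocycle hA hres zc.
have /choice[b bP] j : exists N, forall N', (N <= N')%N -> trunc_left N' (m j) = m j.
  exact: trunc_left_bound.
rewrite -[z](subrK z'); apply: coboundaryD => //.
apply: (@bounded_var_comm_inj n (\max_j b j)) => // [v|].
  have [t ->] := z'E v; have [tl tL tR] := trunc_left_map (\max_j b j).
  rewrite (lin_sum tl); apply: eq_bigr => p _; rewrite tL tR bP //.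
  exact: leq_bigmax.
rewrite -[z'](subKr z) (linB (@var_comm_linear _ _ _ _ E _ _ _)).
by apply: coboundaryB => //; exact: var_comm_coboundary.
Qed.

End LeadingCoefficient.

(** * The short exact sequence *)

Section HomOfRelation.
Variables (k : comPzRingType) (C D : kAlgType k) (U V : bimodule C D).

(** The connecting map is determined on classes by a relation between cocycles
    and involves choices; linearity and compatibility with the actions can be
    checked on the relation, where they are evident. *)
Lemma bimod_hom_of_rel (R : U -> V -> Prop) :
  (forall u, exists v, R u v) -> (forall u v v', R u v -> R u v' -> v = v') ->
  (forall c u u' v v', R u v -> R u' v' -> R (c *: u + u') (c *: v + v')) ->
  (forall b u v, R u v -> R (lact (bimod_str U) b u) (lact (bimod_str V) b v)) ->
  (forall b u v, R u v -> R (ract (bimod_str U) u b) (ract (bimod_str V) v b)) ->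
  exists g : bimod_hom U V, forall u, R u (g u).
Proof.
move=> /choice[g gR] Ru Rl RL RR.
have gl : linear g by move=> c u u'; apply: (Ru _ _ _ (gR _)); apply: Rl.
have [g' gE] := linear_pack gl.
have g'L b u : g' (lact (bimod_str U) b u) = lact (bimod_str V) b (g' u).
  by rewrite !gE; apply: (Ru _ _ _ (gR _)); apply: RL.
have g'R u b : g' (ract (bimod_str U) u b) = ract (bimod_str V) (g' u) b.
  by rewrite !gE; apply: (Ru _ _ _ (gR _)); apply: RR.
by exists (BimodHom g'L g'R) => u /=; rewrite gE.
Qed.

End HomOfRelation.

Section Classes.
Variables (k : comPzRingType) (B : kAlgType k) (M : lmodType k) (s : bimod_on B B M).

Definition mk_cocycle n (f : ('I_n -> B) -> M) (h : is_cocycle s f) : cocycle s n :=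
  Cocycle (asboolT h).

Lemma cocycleE n (f : cocycle s n) : is_cocycle s f.
Proof. by case: f => f /= /asboolP. Qed.

Lemma hclass_eq n (f g : cocycle s n) :
  hclass f = hclass g <-> is_coboundary s ((f : ('I_n -> B) -> M) - (g : ('I_n -> B) -> M)).
Proof. by rewrite -cocycle_funB; exact: hclassP. Qed.

Lemma hclass_eq0 n (f : cocycle s n) : hclass f = 0 <-> is_coboundary s f.
Proof.
rewrite -(lin0 (@hclass_linear k B M s n)) hclass_eq.
by rewrite -[X in _ - X]/(0 : ('I_n -> B) -> M) subr0.
Qed.

End Classes.

Section Assembly.
Variables (k : comPzRingType) (A : kAlgType k) (sigma : alg_aut A).
Variables (delta : skew_derivation sigma) (E : ore_extension delta).
Local Notation EE := (tensor E E).
Local Notation out := (outer_on E).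

(** Reparametrization by sigma passes from the twist by the inverse of sigma on
    the right to the twist by sigma on the left. *)
Definition pull n (h : ('I_n -> A) -> EE) : ('I_n -> A) -> EE := fun v => h (sigma \o v).
Definition push n (h : ('I_n -> A) -> EE) : ('I_n -> A) -> EE :=
  fun v => h (aut_inv sigma \o v).

Lemma pushK n (h : ('I_n -> A) -> EE) : pull (push h) = h.
Proof.
by apply/funext => v; congr h; apply/funext => i; exact: autK.
Qed.

Lemma pullK n (h : ('I_n -> A) -> EE) : push (pull h) = h.
Proof.
by apply/funext => v; congr h; apply/funext => i; exact: aut_invK.
Qed.

Lemma pull_multilinear n (h : ('I_n -> A) -> EE) : multilinear h -> multilinear (pull h).
Proof.
move=> hm; apply: (multilinear_comp (phi := id) (g := fun=> sigma)) => // i.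
exact: alg_hom_linear.
Qed.

Lemma push_multilinear n (h : ('I_n -> A) -> EE) : multilinear h -> multilinear (push h).
Proof.
move=> hm; apply: (multilinear_comp (phi := id) (g := fun=> aut_inv sigma)) => // i.
exact: alg_hom_linear.
Qed.

Lemma pull_hdiff n (h : ('I_n -> A) -> EE) :
  hdiff (tw_on out) (pull h) = pull (hdiff (EEtwist_on E) h).
Proof.
rewrite !hdiffE; apply: (@rdiff_natural k A A EE EE sigma id (rmorphM sigma)) => // m c.
by rewrite /= autK.
Qed.

Lemma pull_cocycle n (h : ('I_n -> A) -> EE) :
  is_cocycle (EEtwist_on E) h <-> is_cocycle (tw_on out) (pull h).
Proof.
split=> [[hm hd]|[hm hd]]; split.
- exact: pull_multilinear.
- by rewrite pull_hdiff hd.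
- by rewrite -[h]pullK; exact: push_multilinear.
by rewrite -[LHS]pullK -pull_hdiff hd.
Qed.

Lemma pull_coboundary n (h : ('I_n -> A) -> EE) :
  is_coboundary (EEtwist_on E) h <-> is_coboundary (tw_on out) (pull h).
Proof.
case: n h => [|n] h /=; first by split=> [->|e] //; rewrite -[h]pullK e.
split=> [[g [gm ->]]|[g [gm e]]].
  by exists (pull g); rewrite pull_hdiff; split=> //; exact: pull_multilinear.
exists (push g); split; first exact: push_multilinear.
by rewrite -[RHS]pullK -pull_hdiff pushK -e pullK.
Qed.

Lemma cone_coboundary_lin n c (y1 z1 : ('I_n.+1 -> A) -> EE) (y2 z2 : ('I_n -> A) -> EE) :
  cone_coboundary out y1 y2 -> cone_coboundary out z1 z2 ->
  cone_coboundary out (c *: y1 + z1) (c *: y2 + z2).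
Proof.
move=> [f [fm fd fx]] [g [gm gd gx]]; exists (c *: f + g); split.
- exact: multilinearP.
- by rewrite hdiffD hdiffZ fd gd.
rewrite (@var_comm_linear _ _ _ _ E) (_ : _ - _ =
    c *: (y2 - var_comm out f) + (z2 - var_comm out g)).
  exact: is_coboundaryP.
by move: (var_comm out f) (var_comm out g) => a b; rewrite scalerBr; abelian.
Qed.

Lemma cone_coboundary_map n phi (y1 : ('I_n.+1 -> A) -> EE) (y2 : ('I_n -> A) -> EE) :
  bimod_map out out phi -> cone_coboundary out y1 y2 ->
  cone_coboundary out (phi \o y1) (phi \o y2).
Proof.
move=> pm [f [fm fd fx]]; have [pl _ _] := pm; exists (phi \o f); split.
- exact: multilinear_post.
- by rewrite (hdiff_map (res_map pm)) fd.
rewrite (var_comm_map pm) -(postB pl); exact: (coboundary_map (tw_map pm)).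
Qed.

Variable n : nat.
Local Notation H1 := (HH_bimodule (EE_commute E) n).
Local Notation H2 := (HH_bimodule (EEtwist_commute E) n).
Local Notation H3 := (HH_bimodule (outer_inner_commute E) n.+1).

Definition rel_f (u : H1) (v : H2) : Prop :=
  exists (z : cocycle (EE_on E) n) (h : cocycle (EEtwist_on E) n),
  [/\ u = hclass z, v = hclass h & pull h = var_comm out z].

(** The class of h is sent to that of F when the images of (0, h) and F in the
    cone are cohomologous. *)
Definition rel_g (u : H2) (v : H3) : Prop :=
  exists (h : cocycle (EEtwist_on E) n) (F : cocycle out n.+1),
  [/\ u = hclass h, v = hclass F &
      cone_coboundary out (- restr F) (pull h - var_slots F)].

Lemma push_var_comm_cocycle (z : ('I_n -> A) -> EE) :
  is_cocycle (res_on out) z -> is_cocycle (EEtwist_on E) (push (var_comm out z)).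
Proof.
move=> [zm zd]; apply/pull_cocycle; rewrite pushK; split; first exact: var_comm_multilinear.
by rewrite -var_comm_hdiff // zd (lin0 (@var_comm_linear _ _ _ _ E _ _ _)).
Qed.

Lemma rel_f_total u : exists v, rel_f u v.
Proof.
have c := push_var_comm_cocycle (cocycleE (repr u : cocycle (EE_on E) n)).
exists (hclass (mk_cocycle c)), (repr u), (mk_cocycle c); split=> //.
  by rewrite hclass_repr.
by rewrite /= pushK.
Qed.

(** One equivalence says at once that f is well defined and that it is
    injective. *)
Lemma rel_fP u v u' v' : projective_module A -> has_fg_projective_resolution A ->
  rel_f u v -> rel_f u' v' -> u = u' <-> v = v'.
Proof.
move=> hA hres [z [h [-> -> hz]]] [z' [h' [-> -> hz']]].
rewrite !hclass_eq pull_coboundary.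
have e : pull ((h : _ -> EE) - (h' : _ -> EE)) =
    var_comm out ((z : _ -> EE) - (z' : _ -> EE)).
  by rewrite (linB (@var_comm_linear _ _ _ _ E _ _ _)) -hz -hz'.
rewrite e; split; first exact: var_comm_coboundary.
apply: var_comm_inj => //; split; have [zm zd] := cocycleE z; have [zm' zd'] := cocycleE z'.
  by apply: multilinear_add => //; exact: multilinear_opp.
by rewrite hdiffB zd zd' subrr.
Qed.

Lemma inner_lact_map b : bimod_map out out (lact (inner_on E) b).
Proof. by have [h _] := outer_inner_commute E; exact: h. Qed.

Lemma inner_ract_map b : bimod_map out out ((ract (inner_on E))^~ b).
Proof. by have [_ h] := outer_inner_commute E; exact: h. Qed.

Lemma rel_f_linear c u u' v v' : rel_f u v -> rel_f u' v' -> rel_f (c *: u + u') (c *: v + v').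
Proof.
move=> [z [h [-> -> e]]] [z' [h' [-> -> e']]].
exists (c *: z + z'), (c *: h + h'); rewrite !hclass_linear; split=> //.
by rewrite !cocycle_funP (@var_comm_linear _ _ _ _ E) -e -e'.
Qed.

Lemma rel_f_lact b u v : rel_f u v ->
  rel_f (lact (bimod_str H1) b u) (lact (bimod_str H2) b v).
Proof.
move=> [z [h [-> -> e]]].
exists (cocycle_map ((EE_commute E).1 b) z), (cocycle_map ((EEtwist_commute E).1 b) h).
by split; rewrite /= ?HH_mapE // (var_comm_map (inner_lact_map b)) -e.
Qed.

Lemma rel_f_ract b u v : rel_f u v ->
  rel_f (ract (bimod_str H1) u b) (ract (bimod_str H2) v b).
Proof.
move=> [z [h [-> -> e]]].
exists (cocycle_map ((EE_commute E).2 b) z), (cocycle_map ((EEtwist_commute E).2 b) h).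
by split; rewrite /= ?HH_mapE // (var_comm_map (inner_ract_map b)) -e.
Qed.

Lemma rel_g_total u : exists v, rel_g u v.
Proof.
have /pull_cocycle[hm hd] := cocycleE (repr u : cocycle (EEtwist_on E) n).
set h := repr u : cocycle (EEtwist_on E) n in hm hd.
have v0 := lin0 (@var_comm_linear _ _ _ _ E _ out n.+1).
have [||F [Fc Fx]] := @comparison_surj _ _ _ _ E n _ out 0 (pull h) _ hm.
- by split; [exact: multilinear0|exact: hdiff0].
- by rewrite hd v0.
exists (hclass (mk_cocycle Fc)), h, (mk_cocycle Fc); split=> //; first by rewrite hclass_repr.
by rewrite sub0r in Fx.
Qed.

Lemma rel_g_linear c u u' v v' : rel_g u v -> rel_g u' v' -> rel_g (c *: u + u') (c *: v + v').
Proof.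
move=> [h [F [-> -> e]]] [h' [F' [-> -> e']]].
exists (c *: h + h'), (c *: F + F'); rewrite !hclass_linear; split=> //.
have := cone_coboundary_lin c e e'; congr cone_coboundary.
  by rewrite cocycle_funP scalerN -opprD.
by rewrite !cocycle_funP (@var_slots_linear _ _ _ _ E) scalerBr addrACA -opprD.
Qed.

Lemma rel_g_lact b u v : rel_g u v ->
  rel_g (lact (bimod_str H2) b u) (lact (bimod_str H3) b v).
Proof.
move=> [h [F [-> -> e]]]; have im := inner_lact_map b; have [il _ _] := im.
exists (cocycle_map ((EEtwist_commute E).1 b) h), (cocycle_map ((outer_inner_commute E).1 b) F).
split; rewrite /= ?HH_mapE //.
have := cone_coboundary_map im e; congr cone_coboundary.
  by apply/funext => w; exact: linN il _.
by rewrite (postB il) (var_slots_map im).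
Qed.

Lemma rel_g_ract b u v : rel_g u v ->
  rel_g (ract (bimod_str H2) u b) (ract (bimod_str H3) v b).
Proof.
move=> [h [F [-> -> e]]]; have im := inner_ract_map b; have [il _ _] := im.
exists (cocycle_map ((EEtwist_commute E).2 b) h), (cocycle_map ((outer_inner_commute E).2 b) F).
split; rewrite /= ?HH_mapE //.
have := cone_coboundary_map im e; congr cone_coboundary.
  by apply/funext => w; exact: linN il _.
by rewrite (postB il) (var_slots_map im).
Qed.

Lemma rel_g_fun u v v' : rel_g u v -> rel_g u v' -> v = v'.
Proof.
move=> [h [F [-> -> e]]] [h' [F' [/hclass_eq/pull_coboundary hh' -> e']]].
apply/hclass_eq; apply: comparison_inj.
  have [Fm Fd] := cocycleE F; have [Fm' Fd'] := cocycleE F'.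
  split; first by apply: multilinear_add => //; exact: multilinear_opp.
  by rewrite hdiffB Fd Fd' subrr.
have [f [fm fd fx]] := cone_coboundary_lin (-1) e e'; exists f; split=> //.
  by rewrite fd scaleN1r opprK.
have := coboundaryD fx hh'; congr is_coboundary.
rewrite (linB (@var_slots_linear _ _ _ _ E _ _)) scaleN1r.
have -> : pull ((h : _ -> EE) - (h' : _ -> EE)) = pull h - pull h' by [].
by move: (var_comm out f) (var_slots F) (var_slots F') => a b c; abelian.
Qed.

(** If F = d G, then (0, h) is a coboundary in the cone, and its primitive has
    for first component, after correction by the restriction of G, a cocycle of
    A whose commutator is h up to a coboundary. *)
Lemma rel_g_kernel u : rel_g u 0 <-> exists z, rel_f z u.
Proof.
split=> [[h [F [-> /esym/hclass_eq0[G [Gm Gd]] [f [fm fd fx]]]]]|[z0 [z [h [_ -> e]]]]].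
  have zc : is_cocycle (EE_on E) (f + restr G).
    split; first by apply: multilinear_add => //; exact: restr_multilinear.
    by rewrite hdiffD -[EE_on E]/(res_on out) fd restr_hdiff -Gd addNr.
  exists (hclass (mk_cocycle zc)), (mk_cocycle zc), (mk_cocycle (push_var_comm_cocycle zc)).
  split=> //; last exact: pushK.
  apply/hclass_eq/pull_coboundary.
  have := coboundaryD fx (var_slots_hdiff_coboundary out Gm).
  congr is_coboundary; rewrite -Gd /=.
  have -> : pull ((h : _ -> EE) - push (var_comm out (f + restr G))) =
      pull h - pull (push (var_comm out (f + restr G))) by [].
  rewrite pushK (linD (@var_comm_linear _ _ _ _ E _ _ _)).
  move: (var_comm out f) (var_comm out (restr G)) (var_slots F) => a b c; abelian.
exists h, 0; split=> //; first by rewrite (lin0 (@hclass_linear _ _ _ _ _)).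
have [zm zd] := cocycleE z; exists z; split=> //.
  by rewrite -[EE_on E]/(res_on out) in zd; rewrite zd; apply/funext => v; rewrite -[LHS]oppr0.
rewrite e (_ : _ - _ = 0); first exact: coboundary0.
rewrite -[var_slots _]/(var_slots (0 : _ -> EE)) (lin0 (@var_slots_linear _ _ _ _ E _ _)).
by rewrite subr0 subrr.
Qed.

(** The restriction of F to A has commutator zero in cohomology, by the second
    component of the cocycle.  By injectivity it is a coboundary d f, and
    subtracting f from the pair leaves one of the form (0, h). *)
Lemma rel_g_onto v : projective_module A -> has_fg_projective_resolution A ->
  exists u, rel_g u v.
Proof.
move=> hA hres; have [Fm Fd] := cocycleE (repr v : cocycle out n.+1).
set F := repr v : cocycle out n.+1 in Fm Fd *.
have rFc : is_cocycle (res_on out) (restr F).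
  by split; [exact: restr_multilinear|rewrite restr_hdiff Fd].
have rFx : hdiff (tw_on out) (var_slots F) = var_comm out (restr F).
  have := var_slots_hdiff out Fm; rewrite Fd (lin0 (@var_slots_linear _ _ _ _ E _ _)).
  by move/esym/eqP; rewrite subr_eq0 => /eqP.
have [|f [fm fd]] := var_comm_inj hA hres rFc.
  by exists (var_slots F); split; [exact: var_slots_multilinear|rewrite rFx].
have hc : is_cocycle (EEtwist_on E) (push (var_slots F - var_comm out f)).
  apply/pull_cocycle; rewrite pushK; split.
    apply: multilinear_add; first exact: var_slots_multilinear.
    by apply: multilinear_opp; exact: var_comm_multilinear.
  by rewrite hdiffB rFx fd var_comm_hdiff // subrr.
exists (hclass (mk_cocycle hc)), (mk_cocycle hc), F; split=> //; first by rewrite hclass_repr.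
exists (- f); split; first exact: multilinear_opp.
  by rewrite hdiffN -fd.
rewrite /= pushK (linN (@var_comm_linear _ _ _ _ E _ _ _)) (_ : _ - _ = 0).
  exact: coboundary0.
by move: (var_comm out f) (var_slots F) => a b; abelian.
Qed.

End Assembly.

Theorem theorem0p1 (k : comPzRingType) (A : kAlgType k) (sigma : alg_aut A)
    (delta : skew_derivation sigma) (E : ore_extension delta)
    (hA : projective_module A) (hres : has_fg_projective_resolution A)
    (n : nat) :
  exists (f : bimod_hom (HH_bimodule (EE_commute E) n)
                        (HH_bimodule (EEtwist_commute E) n))
         (g : bimod_hom (HH_bimodule (EEtwist_commute E) n)
                        (HH_bimodule (outer_inner_commute E) n.+1)),
    short_exact f g.
Proof.
have fP u v u' v' := @rel_fP k A sigma delta E n u v u' v' hA hres.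
have [|||||f fR] := @bimod_hom_of_rel k E E _ _ (@rel_f k A sigma delta E n).
- exact: rel_f_total.
- by move=> u v v' h /(fP _ _ _ _ h) [e _]; exact: e.
- exact: rel_f_linear.
- exact: rel_f_lact.
- exact: rel_f_ract.
have [|||||g gR] := @bimod_hom_of_rel k E E _ _ (@rel_g k A sigma delta E n).
- exact: rel_g_total.
- exact: rel_g_fun.
- exact: rel_g_linear.
- exact: rel_g_lact.
- exact: rel_g_ract.
exists f, g; split.
- by move=> u u' e; apply/(fP _ _ _ _ (fR u) (fR u')).
- move=> y; split=> [gy0|[u <-]].
    have [|u uy] := (rel_g_kernel y).1; first by rewrite -gy0.
    by exists u; apply/(fP _ _ _ _ (fR u) uy).
  by apply: rel_g_fun (gR _) _; apply/rel_g_kernel; exists u.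
- move=> v; have [u uv] := rel_g_onto v hA hres.
  by exists u; exact: rel_g_fun (gR u) uv.
Qed.
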